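(* Let $H$ be a semisimple Hopf algebra over $\Bbbk$, let $V$ be a left Yetter-Drinfeld module over $H$ whose braiding $c=c_{V,V}$ satisfies $c^2=\mathrm{id}_{V\otimes V}$, and let $A=\mathfrak B(V)\#H$. Let $\eta:V\otimes V\to\Bbbk$ be an $H$-invariant linear functional. Then $\sigma=e^{\tilde\eta}\in\mathrm{Hom}_\Bbbk(A\otimes A,\Bbbk)$ is a multiplicative $2$-cocycle on $A$.
   Context: $\Bbbk$ is an algebraically closed field of characteristic zero. The braiding of a left Yetter-Drinfeld module $V$ over $H$ is $c(x\otimes y)=x_{(-1)}\cdot y\otimes x_{(0)}$. $\mathfrak B(V)=\bigoplus_{n\ge0}\mathfrak B^n(V)$ is the Nichols algebra of $V$ (the quotient of $T(V)$ by the largest homogeneous two-sided ideal, generated in degrees $\ge2$, that is also a coideal) and $A=\mathfrak B(V)\#H$ is the bosonization (Majid-Radford biproduct), graded by $A_n=\mathfrak B^n(V)\#H$. $\eta:V\otimes V\to\Bbbk$ is $H$-invariant if $\eta(h_{(1)}\cdot x,h_{(2)}\cdot y)=\varepsilon(h)\eta(x,y)$ for all $h\in H$, $x,y\in V$. Then $\tilde\eta:A\otimes A\to\Bbbk$ is defined by $\tilde\eta(A_a\otimes A_b)=0$ for $(a,b)\ne(1,1)$ and $\tilde\eta(x\#h,y\#h')=\eta(x,h\cdot y)\varepsilon(h')$ for $x,y\in V$, $h,h'\in H$; and $e^{\tilde\eta}=\sum_{i\ge0}\tilde\eta^{*i}/i!$ (convolution powers; well defined since $\tilde\eta$ vanishes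 on $A_0\otimes A+A\otimes A_0$). A multiplicative $2$-cocycle on $A$ is a convolution invertible linear map $\sigma:A\otimes A\to\Bbbk$ with $\sigma(b_{(1)},c_{(1)})\sigma(a,b_{(2)}c_{(2)})=\sigma(a_{(1)},b_{(1)})\sigma(a_{(2)}b_{(2)},c)$ and $\sigma(a,1)=\varepsilon(a)=\sigma(1,a)$ for all $a,b,c\in A$. *)

(* Defs.v *)
From HB Require Import structures.
From mathcomp Require Import all_boot all_order all_algebra generic_quotient.
From mathcomp Require Import boolp.
Set Implicit Arguments. Unset Strict Implicit. Unset Printing Implicit Defensive.
Import GRing.Theory.
Local Open Scope ring_scope.
Local Open Scope quotient_scope.

Definition bilin (k : fieldType) (U W X : lmodType k) (f : U -> W -> X) : Prop :=
  (forall w, linear (f ^~ w)) /\ (forall u, linear (f u)).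

(* The tensor product of U and W over k: formal sums of pairs, two of them being
   identified when every bilinear map to every k-module takes the same value on
   both. The universal property is [swe_linear], [swe_tensor] and [tens_ext]:
   [swe t f] is the value at [t] of the linear map induced by a bilinear [f].
   It is written [\sw_(a, b <- t) f a b], so that Sweedler's expression
   f(h_(1), h_(2)) reads [\sw_(h1, h2 <- comul h) f h1 h2]. For [f] not bilinear
   the value depends on the chosen representative of [t] and means nothing. *)
Section Tensor.
Variables (k : fieldType) (U W : lmodType k).

Definition ev (X : lmodType k) (f : U -> W -> X) (s : seq (U * W)) : X :=
  \sum_(p <- s) f p.1 p.2.

Definition tequiv (s t : seq (U * W)) : bool :=
  `[< forall (X : lmodType k) (f : U -> W -> X), bilin f -> ev f s = ev f t >].

Lemma tequiv_refl : reflexive tequiv.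
Proof. by move=> s; apply/asboolP. Qed.
Lemma tequiv_sym : symmetric tequiv.
Proof.
move=> s t; apply/idP/idP => /asboolP E; apply/asboolP => X f Hf; by rewrite E.
Qed.
Lemma tequiv_trans : transitive tequiv.
Proof.
move=> t s r /asboolP E1 /asboolP E2; apply/asboolP => X f Hf.
by rewrite E1 // E2.
Qed.
Canonical tequiv_equiv := EquivRel tequiv tequiv_refl tequiv_sym tequiv_trans.

Definition tens := {eq_quot tequiv_equiv}.
HB.instance Definition _ := Choice.on tens.
HB.instance Definition _ := Quotient.on tens.

Definition swe (X : lmodType k) (t : tens) (f : U -> W -> X) : X := ev f (repr t).

Lemma swe_pi (X : lmodType k) (f : U -> W -> X) s :
  bilin f -> swe (\pi_tens s) f = ev f s.
Proof.
move=> Hf; rewrite /swe; have /eqmodP/asboolP := reprK (\pi_tens s); exact.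
Qed.

Lemma tens_eqP (s t : tens) :
  (forall (X : lmodType k) (f : U -> W -> X), bilin f -> swe s f = swe t f) ->
  s = t.
Proof.
move=> E; rewrite -[s]reprK -[t]reprK; apply/eqmodP/asboolP => X f Hf.
exact: E.
Qed.

Definition tadd (s t : tens) : tens := \pi_tens (repr s ++ repr t).
Definition tscale (a : k) (s : tens) : tens :=
  \pi_tens [seq (a *: p.1, p.2) | p <- repr s].
Definition tzero : tens := \pi_tens [::].

Lemma swe_add (X : lmodType k) (f : U -> W -> X) s t : bilin f -> 
  swe (tadd s t) f = swe s f + swe t f.
Proof. by move=> Hf; rewrite swe_pi // /ev big_cat. Qed.
Lemma swe_zero (X : lmodType k) (f : U -> W -> X) : bilin f -> swe tzero f = 0.
Proof. by move=> Hf; rewrite swe_pi // /ev big_nil. Qed.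
Lemma swe_scale0 (X : lmodType k) (f : U -> W -> X) a s : bilin f ->
  swe (tscale a s) f = a *: swe s f.
Proof.
move=> Hf; rewrite swe_pi // /ev big_map scaler_sumr; apply: eq_bigr => p _ /=.
by have [Hl _] := Hf; have := GRing.scalable_linear (Hl p.2); apply.
Qed.

Fact taddA : associative tadd.
Proof. by move=> x y z; apply: tens_eqP => X f Hf; rewrite !swe_add // addrA. Qed.
Fact taddC : commutative tadd.
Proof. by move=> x y; apply: tens_eqP => X f Hf; rewrite !swe_add // addrC. Qed.
Fact tadd0 : left_id tzero tadd.
Proof. by move=> x; apply: tens_eqP => X f Hf; rewrite swe_add // swe_zero // add0r. Qed.
Fact taddN : left_inverse tzero (tscale (-1)) tadd.
Proof.
by move=> x; apply: tens_eqP => X f Hf; rewrite swe_add // swe_zero // swe_scale0 // scaleN1r addNr.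
Qed.
HB.instance Definition _ := GRing.isZmodule.Build tens taddA taddC tadd0 taddN.

Fact tscaleA a b v : tscale a (tscale b v) = tscale (a * b) v.
Proof. by apply: tens_eqP => X f Hf; rewrite !swe_scale0 // scalerA. Qed.
Fact tscale1 : left_id 1 tscale.
Proof. by move=> v; apply: tens_eqP => X f Hf; rewrite swe_scale0 // scale1r. Qed.
Fact tscaleDr : right_distributive tscale +%R.
Proof. by move=> a u v; apply: tens_eqP => X f Hf; rewrite !(swe_scale0, swe_add) // scalerDr. Qed.
Fact tscaleDl v : {morph tscale^~ v : a b / a + b}.
Proof. by move=> a b; apply: tens_eqP => X f Hf; rewrite !(swe_scale0, swe_add) // scalerDl. Qed.
HB.instance Definition _ := GRing.Zmodule_isLmodule.Build k tens tscaleA tscale1 tscaleDr tscaleDl.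


Definition tensor (u : U) (w : W) : tens := \pi_tens [:: (u, w)].

Lemma swe_tensor (X : lmodType k) (f : U -> W -> X) u w :
  bilin f -> swe (tensor u w) f = f u w.
Proof. by move=> Hf; rewrite swe_pi // /ev big_seq1. Qed.

Lemma tensor_bilin : bilin tensor.
Proof.
split=> [w a u u'|u a w w']; apply: tens_eqP => X f Hf;
  rewrite [RHS]swe_add // swe_scale0 // !swe_tensor //.
  by case: Hf => Hf _; exact: Hf.
by case: Hf => _ Hf; exact: Hf.
Qed.

Lemma swe_linear (X : lmodType k) (f : U -> W -> X) : bilin f -> linear (fun t : tens => swe t f).
Proof. by move=> Hf a s t; rewrite [LHS]swe_add // swe_scale0. Qed.

Lemma swe_sumE (X : lmodType k) (f : U -> W -> X) (t : tens) : 
  swe t f = \sum_(p <- repr t) f p.1 p.2.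
Proof. by []. Qed.

Lemma tens_repr (t : tens) : t = swe t tensor.
Proof.
apply: tens_eqP => X f Hf.
transitivity (\sum_(p <- repr t) swe (tensor p.1 p.2) f).
  by apply: eq_bigr => p _; rewrite swe_tensor.
rewrite (swe_sumE tensor); elim: (repr t) => [|p s IH].
  by rewrite !big_nil [RHS]swe_zero.
by rewrite !big_cons IH [RHS]swe_add.
Qed.
End Tensor.

Notation "u \ox w" := (tensor u w) (at level 45, left associativity) : ring_scope.
Notation "\sw_ ( a , b <- t ) F" := (swe t (fun a b => F))
  (at level 200, a name, b name, t at level 100, F at level 200,
   format "\sw_ ( a , b  <-  t )  F") : ring_scope.

HB.mixin Record isCoalgebra (k : fieldType) C of GRing.Lmodule k C := {
  comul : {linear C -> tens C C};
  counit : {scalar C};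
  comulA : forall c : C,
    (\sw_(a, b <- comul c) \sw_(a1, a2 <- comul a) a1 \ox (a2 \ox b)) =
    (\sw_(a, b <- comul c) \sw_(b1, b2 <- comul b) a \ox (b1 \ox b2));
  counitl : forall c : C, (\sw_(a, b <- comul c) counit a *: b) = c;
  counitr : forall c : C, (\sw_(a, b <- comul c) counit b *: a) = c
}.
#[short(type="coalgType")]
HB.structure Definition Coalgebra (k : fieldType) :=
  {C of isCoalgebra k C & GRing.Lmodule k C}.

#[short(type="algCoalgType")]
HB.structure Definition AlgCoalgebra (k : fieldType) :=
  {A of GRing.Algebra k A & Coalgebra k A}.

HB.mixin Record isBialgebra (k : fieldType) A of AlgCoalgebra k A := {
  comul1 : comul (1 : A) = 1 \ox 1;
  comulM : forall x y : A, comul (x * y) =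
     \sw_(x1, x2 <- comul x) \sw_(y1, y2 <- comul y) (x1 * y1) \ox (x2 * y2);
  counit1 : counit (1 : A) = 1;
  counitM : forall x y : A, counit (x * y) = counit x * counit y
}.
#[short(type="bialgType")]
HB.structure Definition Bialgebra (k : fieldType) :=
  {A of isBialgebra k A & AlgCoalgebra k A}.

HB.mixin Record hasAntipode (k : fieldType) H of Bialgebra k H := {
  antipode : {linear H -> H};
  antipodel : forall h : H,
    (\sw_(h1, h2 <- comul h) antipode h1 * h2) = counit h *: 1;
  antipoder : forall h : H,
    (\sw_(h1, h2 <- comul h) h1 * antipode h2) = counit h *: 1
}.
#[short(type="hopfType")]
HB.structure Definition Hopf (k : fieldType) := {H of hasAntipode k H & Bialgebra k H}.

HB.mixin Record isYetterDrinfeld (k : fieldType) (H : hopfType k) V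
    of GRing.Lmodule k V := {
  act : H -> V -> V;
  coact : {linear V -> tens H V};
  act_bilin : bilin act;
  act1 : forall v : V, act 1 v = v;
  actM : forall (g h : H) (v : V), act (g * h) v = act g (act h v);
  coactA : forall v : V,
    (\sw_(g, w <- coact v) \sw_(g1, g2 <- comul g) g1 \ox (g2 \ox w)) =
    (\sw_(g, w <- coact v) \sw_(g', w' <- coact w) g \ox (g' \ox w'));
  coact1 : forall v : V, (\sw_(g, w <- coact v) counit g *: w) = v;
  (* h1 v_(-1) (x) h2.v_(0) = (h1.v)_(-1) h2 (x) (h1.v)_(0) *)
  act_coact : forall (h : H) (v : V),
    (\sw_(h1, h2 <- comul h) \sw_(g, w <- coact v) (h1 * g) \ox act h2 w) =
    (\sw_(h1, h2 <- comul h) \sw_(g, w <- coact (act h1 v)) (g * h2) \ox w)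
}.
#[short(type="ydType")]
HB.structure Definition YetterDrinfeld (k : fieldType) (H : hopfType k) :=
  {V of isYetterDrinfeld k H V & GRing.Lmodule k V}.


(* A bialgebra in the braided category of left Yetter-Drinfeld modules: an
   algebra and a coalgebra all of whose structure maps are linear and colinear
   over H, with [comul] multiplicative for the braided product of B (x) B. *)
HB.mixin Record isBraidedBialgebra (k : fieldType) (H : hopfType k) B
    of AlgCoalgebra k B & YetterDrinfeld k H B := {
  act_one : forall h : H, act h (1 : B) = counit h *: (1 : B);
  act_mul : forall (h : H) (x y : B),
    act h (x * y) = \sw_(h1, h2 <- comul h) act h1 x * act h2 y;
  coact_one : coact (1 : B) = (1 : H) \ox (1 : B);
  coact_mul : forall x y : B, coact (x * y) =
    \sw_(g, x0 <- coact x) \sw_(g', y0 <- coact y)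
      ((g : H) * g') \ox (x0 * y0);
  counit_act : forall (h : H) (x : B),
    counit (act h x) = counit h * counit x;
  comul_act : forall (h : H) (x : B), comul (act h x) =
    \sw_(h1, h2 <- comul h) \sw_(x1, x2 <- comul x) act h1 x1 \ox act h2 x2;
  counit_coact : forall x : B,
    (\sw_(g, x0 <- coact x) counit x0 *: (g : H)) = counit x *: 1;
  comul_coact : forall x : B,
    (\sw_(g, x0 <- coact x) \sw_(a, b <- comul x0) (g : H) \ox (a \ox b)) =
    (\sw_(a, b <- comul x) \sw_(g, a0 <- coact a) \sw_(g', b0 <- coact b)
      ((g : H) * g') \ox (a0 \ox b0));
  comul_one : comul (1 : B) = 1 \ox 1;
  comul_braided : forall x y : B, comul (x * y) =
    \sw_(x1, x2 <- comul x) \sw_(y1, y2 <- comul y) \sw_(g, x20 <- coact x2)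
      (x1 * act (g : H) y1) \ox (x20 * y2);
  counit_one : counit (1 : B) = 1;
  counit_mul : forall x y : B, counit (x * y) = counit x * counit y
}.
#[short(type="braidedBialgType")]
HB.structure Definition BraidedBialgebra (k : fieldType) (H : hopfType k) :=
  {B of isBraidedBialgebra k H B & AlgCoalgebra k B & YetterDrinfeld k H B}.

Section SW.
Variable k : fieldType.
Implicit Types U W X Y Z : lmodType k.

Definition islin U X (f : U -> X) : Prop := linear f.

Lemma eq_sw U W X (t : tens U W) (f g : U -> W -> X) :
  (forall a b, f a b = g a b) -> (\sw_(a, b <- t) f a b) = \sw_(a, b <- t) g a b.
Proof. by move=> E; rewrite !swe_sumE; apply: eq_bigr. Qed.

Lemma sw_swap U W U' W' X (s : tens U W) (t : tens U' W')
    (f : U -> W -> U' -> W' -> X) :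
  (\sw_(a, b <- s) \sw_(c, d <- t) f a b c d) =
  (\sw_(c, d <- t) \sw_(a, b <- s) f a b c d).
Proof. rewrite !swe_sumE; under eq_bigr do rewrite swe_sumE.
by rewrite exchange_big; apply: eq_bigr => p _; rewrite swe_sumE. Qed.

Lemma islin_bilin U W X (f : U -> W -> X) :
  (forall w, islin (fun u => f u w)) -> (forall u, islin (fun w => f u w)) -> bilin f.
Proof. by split. Qed.

Lemma islin0 U X (f : U -> X) : islin f -> f 0 = 0.
Proof. move=> Hf; have := Hf (-1) 0 0; by rewrite scaler0 addr0 scaleN1r addNr. Qed.
Lemma islinD U X (f : U -> X) x y : islin f -> f (x + y) = f x + f y.
Proof. by move=> Hf; have := Hf 1 x y; rewrite !scale1r. Qed.
Lemma islinZ U X (f : U -> X) a x : islin f -> f (a *: x) = a *: f x.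
Proof. by move=> Hf; have := Hf a x 0; rewrite !addr0 islin0 // addr0. Qed.

Lemma islin_id U : islin (fun x : U => x). Proof. by []. Qed.
Lemma islin_comp U X Y (g : X -> Y) (f : U -> X) : islin g -> islin f ->
  islin (fun x => g (f x)).
Proof. by move=> Hg Hf a u v; rewrite Hf Hg. Qed.
Lemma islin_linear U X (g : {linear U -> X}) : islin g.
Proof. exact: linearP. Qed.
Lemma islin_scalar U (g : {scalar U}) : islin (g : U -> k^o).
Proof. exact: linearP. Qed.
Lemma islin_swr U W X Y (t : tens U W) (f : Y -> U -> W -> X) :
  (forall a b, islin (fun x => f x a b)) -> islin (fun x => \sw_(a, b <- t) f x a b).
Proof.
move=> Hf a u v; rewrite !swe_sumE scaler_sumr -big_split.
by apply: eq_bigr => p _; apply: Hf.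
Qed.

Lemma islin_swl U W X Y (F : U -> W -> X) (f : Y -> tens U W) : bilin F -> islin f ->
  islin (fun x => swe (f x) F).
Proof. by move=> HF; apply: (islin_comp (swe_linear HF)). Qed.
Lemma islin_tensl Y U W (w : W) (f : Y -> U) : islin f -> islin (fun x => f x \ox w).
Proof. by apply: (islin_comp (proj1 (tensor_bilin U W) w)). Qed.
Lemma islin_tensr Y U W (u : U) (f : Y -> W) : islin f -> islin (fun x => u \ox f x).
Proof. by apply: (islin_comp (proj2 (tensor_bilin U W) u)). Qed.
Lemma islin_mull Y (A : algType k) (y : A) (f : Y -> A) : islin f -> islin (fun x => f x * y).
Proof. by move=> Hf a u v; rewrite Hf mulrDl scalerAl. Qed.
Lemma islin_mulr Y (A : algType k) (y : A) (f : Y -> A) : islin f -> islin (fun x => y * f x).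
Proof. by move=> Hf a u v; rewrite Hf mulrDr scalerAr. Qed.
Lemma islin_scalel Y U (y : U) (f : Y -> k^o) : islin f -> islin (fun x => f x *: y).
Proof. by move=> Hf a u v; rewrite Hf scalerDl scalerA. Qed.
Lemma islin_scaler Y U (a : k) (f : Y -> U) : islin f -> islin (fun x => a *: f x).
Proof. by move=> Hf b u v; rewrite Hf scalerDr !scalerA mulrC. Qed.
Lemma islin_kmull Y (y : k) (f : Y -> k^o) : islin f -> islin (fun x => f x * y : k^o).
Proof. exact: (@islin_mull Y k^o). Qed.
Lemma islin_kmulr Y (y : k) (f : Y -> k^o) : islin f -> islin (fun x => y * f x : k^o).
Proof. exact: (@islin_mulr Y k^o). Qed.
Lemma islin_actl Y (H : hopfType k) (V : ydType H) (v : V) (f : Y -> H) : islin f ->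
  islin (fun x => act (f x) v).
Proof. by apply: (islin_comp (proj1 (@act_bilin k H V) v)). Qed.
Lemma islin_actr Y (H : hopfType k) (V : ydType H) (h : H) (f : Y -> V) : islin f ->
  islin (fun x => act h (f x)).
Proof. by apply: (islin_comp (proj2 (@act_bilin k H V) h)). Qed.
Lemma islin_appl Y U X (g : {linear U -> X}) (f : Y -> U) : islin f -> islin (fun x => g (f x)).
Proof. by apply: (islin_comp (islin_linear g)). Qed.
Lemma islin_apps Y U (g : {scalar U}) (f : Y -> U) : islin f -> islin (fun x => g (f x) : k^o).
Proof. by apply: (islin_comp (islin_scalar g)). Qed.

Lemma sw_apply U W X Y (g : X -> Y) (t : tens U W) (f : U -> W -> X) : islin g ->
  g (\sw_(a, b <- t) f a b) = \sw_(a, b <- t) g (f a b).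
Proof.
move=> Hg; rewrite !swe_sumE; elim: (repr t) => [|p s IH].
  by rewrite !big_nil islin0.
by rewrite !big_cons islinD // IH.
Qed.

Lemma sw_nest U W U' W' X (t : tens U W) (g : U -> W -> tens U' W') (f : U' -> W' -> X) :
  bilin f ->
  (\sw_(c, d <- \sw_(a, b <- t) g a b) f c d) =
  (\sw_(a, b <- t) \sw_(c, d <- g a b) f c d).
Proof. by move=> Hf; exact: (sw_apply _ _ (swe_linear Hf)). Qed.

Lemma tens_ext U W X (f g : tens U W -> X) t : islin f -> islin g ->
  (forall u w, f (u \ox w) = g (u \ox w)) -> f t = g t.
Proof.
by move=> Hf Hg E; rewrite [t]tens_repr !sw_apply //; apply: eq_sw => a b; apply: E.
Qed.

End SW.

Ltac lin1 :=
  match goal with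
  | |- bilin _ => apply: islin_bilin => ? /=
  | |- linear _ => rewrite -/(islin _)
  | |- islin (fun x => x) => apply: islin_id
  | |- islin (fun x => @swe _ _ _ _ ?t (@?f x)) => apply: (@islin_swr _ _ _ _ _ t) => ? ? /=
  | |- islin (fun x => @swe _ ?U ?W ?X (@?f x) ?F) => apply: (@islin_swl _ U W X _ F f)
  | |- islin (fun x => @tensor _ _ _ (@?f x) ?w) => apply: (@islin_tensl _ _ _ _ w f)
  | |- islin (fun x => @tensor _ _ _ ?w (@?f x)) => apply: (@islin_tensr _ _ _ _ w f)
  | |- islin (fun x => (@?f x) * ?w) =>
       first [apply: (@islin_mull _ _ _ w f) | apply: (@islin_kmull _ _ w f)]
  | |- islin (fun x => ?w * (@?f x)) =>
       first [apply: (@islin_mulr _ _ _ w f) | apply: (@islin_kmulr _ _ w f)]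
  | |- islin (fun x => (@?f x) *: ?w) => apply: (@islin_scalel _ _ _ w f)
  | |- islin (fun x => ?w *: (@?f x)) => apply: (@islin_scaler _ _ _ w f)
  | |- islin (fun x => act (@?f x) ?w) => apply: (@islin_actl _ _ _ _ w f)
  | |- islin (fun x => act ?w (@?f x)) => apply: (@islin_actr _ _ _ _ w f)
  | |- islin (fun x => @GRing.Linear.sort _ _ _ _ ?g (@?f x)) =>
       first [apply: (@islin_appl _ _ _ _ g f) | apply: (@islin_apps _ _ _ g f)]
  end.
Ltac lin := repeat lin1.

Section Gen.
Variable k : fieldType.
Implicit Types X : lmodType k.

Definition trilin (U V W X : lmodType k) (f : U -> V -> W -> X) :=
  [/\ forall v w, islin (fun u => f u v w), forall u w, islin (fun v => f u v w) &
   forall u v, islin (fun w => f u v w)].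

Lemma sw_comulA (C : coalgType k) X (f : C -> C -> C -> X) c : trilin f ->
  (\sw_(a, b <- comul c) \sw_(a1, a2 <- comul a) f a1 a2 b) =
  (\sw_(a, b <- comul c) \sw_(b1, b2 <- comul b) f a b1 b2).
Proof.
case=> f1 f2 f3.
have bf a : bilin (f a) by split; [exact: f2 | exact: f3].
pose g (t : tens C (tens C C)) := \sw_(a, s <- t) \sw_(b, d <- s) f a b d.
have bg : bilin (fun a s => \sw_(b, d <- s) f a b d).
  by lin; first [exact: f1 | exact: f2 | exact: f3].
have lg : islin g by rewrite /g; lin.
have := congr1 g (comulA c); rewrite 2!(sw_apply _ _ lg).
under eq_sw => a b.
  rewrite (sw_apply _ _ lg).
  under eq_sw => a1 a2 do rewrite /g swe_tensor ?swe_tensor //.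
  over.
move=> ->; apply: eq_sw => a b; rewrite (sw_apply _ _ lg).
by under eq_sw => a1 a2 do rewrite /g swe_tensor ?swe_tensor //.
Qed.

End Gen.

Ltac trilin := split => ? ? /=; lin.

Section Gen2.
Variable k : fieldType.
Implicit Types X : lmodType k.

Definition ev3 (U V W X : lmodType k) (f : U -> V -> W -> X) (t : tens U (tens V W)) : X :=
  \sw_(a, s <- t) \sw_(b, d <- s) f a b d.

Lemma ev3_bilin (U V W X : lmodType k) (f : U -> V -> W -> X) : trilin f ->
  bilin (fun a (s : tens V W) => \sw_(b, d <- s) f a b d).
Proof. by case=> f1 f2 f3; lin; first [exact: f1 | exact: f2 | exact: f3]. Qed.

Lemma ev3_lin (U V W X : lmodType k) (f : U -> V -> W -> X) : trilin f -> islin (ev3 f).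
Proof. by move=> Hf; apply/swe_linear/ev3_bilin. Qed.

Lemma ev3E (U V W X : lmodType k) (f : U -> V -> W -> X) a b c : trilin f ->
  ev3 f (a \ox (b \ox c)) = f a b c.
Proof.
move=> Hf; rewrite /ev3 swe_tensor; last exact: ev3_bilin.
by rewrite swe_tensor //; case: Hf => f1 f2 f3; split; [move=> ?; exact: f2 | move=> ?; exact: f3].
Qed.

Lemma sw_counitl (C : coalgType k) X (f : C -> X) c : islin f ->
  (\sw_(a, b <- comul c) counit a *: f b) = f c.
Proof.
move=> Hf; rewrite -[in RHS](counitl c) (sw_apply _ _ Hf).
by apply: eq_sw => a b; rewrite islinZ.
Qed.
Lemma sw_counitr (C : coalgType k) X (f : C -> X) c : islin f ->
  (\sw_(a, b <- comul c) counit b *: f a) = f c.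
Proof.
move=> Hf; rewrite -[in RHS](counitr c) (sw_apply _ _ Hf).
by apply: eq_sw => a b; rewrite islinZ.
Qed.

Variable (H : hopfType k).

Lemma sw_coactA (V : ydType H) X (f : H -> H -> V -> X) v : trilin f ->
  (\sw_(g, w <- coact v) \sw_(g1, g2 <- comul g) f g1 g2 w) =
  (\sw_(g, w <- coact v) \sw_(g', w' <- coact w) f g g' w').
Proof.
move=> Hf; have L := ev3_lin Hf.
have := congr1 (ev3 f) (coactA (H := H) v); rewrite 2!(sw_apply _ _ L) => E.
transitivity (\sw_(a, b <- coact v) ev3 f (\sw_(g1, g2 <- comul a) g1 \ox (g2 \ox b))).
  apply: eq_sw => a b; rewrite (sw_apply _ _ L); apply: eq_sw => c d; by rewrite ev3E.
rewrite E; apply: eq_sw => a b; rewrite (sw_apply _ _ L); apply: eq_sw => c d; by rewrite ev3E.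
Qed.

Lemma sw_coact1 (V : ydType H) X (f : V -> X) v : islin f ->
  (\sw_(g, w <- coact v) counit g *: f w) = f v.
Proof.
move=> Hf; rewrite -[in RHS](coact1 (H := H) v) (sw_apply _ _ Hf).
by apply: eq_sw => a b; rewrite islinZ.
Qed.

Lemma sw_act_coact (V : ydType H) X (f : H -> V -> X) h v : bilin f ->
  (\sw_(h1, h2 <- comul h) \sw_(g, w <- coact v) f (h1 * g) (act h2 w)) =
  (\sw_(h1, h2 <- comul h) \sw_(g, w <- coact (act h1 v)) f (g * h2) w).
Proof.
move=> Hf; have L := swe_linear Hf.
have := congr1 (fun t => swe t f) (act_coact h v); rewrite 2!(sw_apply _ _ L) => E.
transitivity (\sw_(h1, h2 <- comul h) swe (\sw_(g, w <- coact v) (h1 * g) \ox act h2 w) f).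
  apply: eq_sw => a b; rewrite (sw_apply _ _ L); apply: eq_sw => c d; by rewrite swe_tensor.
rewrite E; apply: eq_sw => a b; rewrite (sw_apply _ _ L); apply: eq_sw => c d; by rewrite swe_tensor.
Qed.

Variable (B : braidedBialgType H).

Lemma sw_comul_coact X (f : H -> B -> B -> X) (x : B) : trilin f ->
  (\sw_(g, x0 <- coact x) \sw_(a, b <- comul x0) f g a b) =
  (\sw_(a, b <- comul x) \sw_(g, a0 <- coact a) \sw_(g', b0 <- coact b)
      f (g * g') a0 b0).
Proof.
move=> Hf; have L := ev3_lin Hf.
have := congr1 (ev3 f) (comul_coact (s := B) x); rewrite 2!(sw_apply _ _ L) => E.
transitivity (\sw_(g, x0 <- coact x) ev3 f (\sw_(a, b <- comul x0) g \ox (a \ox b))).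
  apply: eq_sw => a b; rewrite (sw_apply _ _ L); apply: eq_sw => c d; by rewrite ev3E.
rewrite E; apply: eq_sw => a b; rewrite (sw_apply _ _ L); apply: eq_sw => c d.
rewrite (sw_apply _ _ L); apply: eq_sw => ? ?; by rewrite ev3E.
Qed.

Lemma sw_counit_coact X (f : H -> X) (x : B) : islin f ->
  (\sw_(g, x0 <- coact x) (counit x0 : k) *: f g) = counit x *: f 1.
Proof.
move=> Hf; rewrite -(islinZ _ _ Hf) -counit_coact (sw_apply _ _ Hf).
by apply: eq_sw => a b; rewrite islinZ.
Qed.

End Gen2.

Section Bos.
Variables (k : fieldType) (H : hopfType k) (B : braidedBialgType H).

(* The Majid-Radford biproduct B # H; [x \ox h] is x # h. *)
Definition bosonization : Type := tens B H.
HB.instance Definition _ := GRing.Lmodule.on bosonization.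

Definition bos_one : bosonization := 1 \ox 1.
Definition bos_mul (s t : bosonization) : bosonization :=
  \sw_(x, h <- s) \sw_(y, h' <- t) \sw_(h1, h2 <- comul h)
    (x * act h1 y) \ox (h2 * h').

Lemma bos_mul_linl t : islin (fun s : tens B H => bos_mul s t).
Proof. rewrite /bos_mul; lin. Qed.
Lemma bos_mul_linr s : islin (fun t : tens B H => bos_mul s t).
Proof. rewrite /bos_mul; lin. Qed.

Lemma bos_mulE x h y h' : bos_mul (x \ox h) (y \ox h') =
  \sw_(h1, h2 <- comul h) (x * act h1 y) \ox (h2 * h').
Proof.
rewrite /bos_mul swe_tensor; last by lin.
by rewrite swe_tensor; last by lin.
Qed.

Fact bos_mul1l : left_id bos_one bos_mul.
Proof.
move=> t; apply: (tens_ext (f := fun t => bos_mul bos_one t) (g := fun t => t)).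
- exact: bos_mul_linr.
- by lin.
move=> x h; rewrite bos_mulE comul1 swe_tensor; last by lin.
by rewrite act1 !mul1r.
Qed.

Fact bos_mul1r : right_id bos_one bos_mul.
Proof.
move=> t; apply: (tens_ext (f := fun t => bos_mul t bos_one) (g := fun t => t)).
- exact: bos_mul_linl.
- by lin.
move=> x h; rewrite bos_mulE.
under eq_sw => h1 h2.
  rewrite act_one -scalerAr !mulr1.
  rewrite (islinZ (f := fun z => z \ox h2)); last by lin.
  over.
by apply: (sw_counitl (f := fun h2 => x \ox h2)); lin.
Qed.

Lemma sw_comulM (X : lmodType k) (f : H -> H -> X) x y : bilin f ->
  (\sw_(a, b <- comul (x * y)) f a b) =
  \sw_(x1, x2 <- comul x) \sw_(y1, y2 <- comul y) f (x1 * y1) (x2 * y2).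
Proof.
move=> Hf; rewrite comulM sw_nest //; apply: eq_sw => a b; rewrite sw_nest //.
by apply: eq_sw => c d; rewrite swe_tensor.
Qed.

Fact bos_mulA : associative bos_mul.
Proof.
move=> s t u.
apply: (tens_ext (f := fun s => bos_mul s (bos_mul t u)) (g := fun s => bos_mul (bos_mul s t) u)).
- exact: bos_mul_linl.
- by apply: (islin_comp (bos_mul_linl u)); exact: bos_mul_linl.
move=> x h.
apply: (tens_ext (f := fun t => bos_mul (x \ox h) (bos_mul t u)) (g := fun t => bos_mul (bos_mul (x \ox h) t) u)).
- by apply: (islin_comp (bos_mul_linr _)); exact: bos_mul_linl.
- by apply: (islin_comp (bos_mul_linl u)); exact: bos_mul_linr.
move=> y g.
apply: (tens_ext (f := fun u => bos_mul (x \ox h) (bos_mul (y \ox g) u)) (g := fun u => bos_mul (bos_mul (x \ox h) (y \ox g)) u)).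
- by apply: (islin_comp (bos_mul_linr _)); exact: bos_mul_linr.
- exact: bos_mul_linr.
move=> z l.
rewrite !bos_mulE (sw_apply _ _ (bos_mul_linr _)) (sw_apply _ _ (bos_mul_linl _)).
transitivity (\sw_(g1, g2 <- comul g) \sw_(h1, h2 <- comul h) \sw_(h21, h22 <- comul h2)
   (x * (act h1 y * act h21 (act g1 z))) \ox (h22 * (g2 * l))).
  apply: eq_sw => g1 g2; rewrite bos_mulE.
  rewrite -(sw_comulA (f := fun a b c => (x * (act a y * act b (act g1 z))) \ox (c * (g2 * l)))); last by trilin.
  apply: eq_sw => h1 h2; rewrite act_mul.
  rewrite (sw_apply _ _ (g := fun a => (x * a) \ox (h2 * (g2 * l)))) //; by lin.
rewrite sw_swap; apply: eq_sw => h1 h2.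
rewrite bos_mulE sw_comulM; last by lin.
rewrite sw_swap; apply: eq_sw => a b; apply: eq_sw => c d.
by rewrite actM !mulrA.
Qed.

Fact bos_mulDl : left_distributive bos_mul +%R.
Proof. by move=> x y z; apply: (islinD (f := fun x => bos_mul x z)) (bos_mul_linl z). Qed.
Fact bos_mulDr : right_distributive bos_mul +%R.
Proof. by move=> z x y; apply: (islinD (f := fun x => bos_mul z x)) (bos_mul_linr z). Qed.

Definition bos_counit (t : bosonization) : k^o := \sw_(x, h <- t) counit x * counit h : k^o.
Lemma bos_counit_lin : islin (fun t : tens B H => bos_counit t).
Proof. rewrite /bos_counit; lin. Qed.
Lemma bos_counitE x h : bos_counit (x \ox h) = counit x * counit h.
Proof. rewrite /bos_counit swe_tensor //; lin. Qed.

Fact bos_one_neq0 : bos_one != 0.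
Proof.
apply/eqP => E; have := bos_counitE 1 1.
rewrite -/bos_one E counit_one counit1 mulr1 (islin0 bos_counit_lin) => /eqP.
by rewrite eq_sym oner_eq0.
Qed.

HB.instance Definition _ := GRing.Zmodule_isNzRing.Build bosonization
  bos_mulA bos_mul1l bos_mul1r bos_mulDl bos_mulDr bos_one_neq0.

Fact bos_scaleAl (a : k) (u v : bosonization) : a *: (u * v) = (a *: u) * v.
Proof. by rewrite -(islinZ (f := fun u => bos_mul u v)) //; exact: bos_mul_linl. Qed.
HB.instance Definition _ := GRing.Lmodule_isLalgebra.Build k bosonization bos_scaleAl.
Fact bos_scaleAr (a : k) (u v : bosonization) : a *: (u * v) = u * (a *: v).
Proof. by rewrite -(islinZ (f := fun v => bos_mul u v)) //; exact: bos_mul_linr. Qed.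
HB.instance Definition _ := GRing.Lalgebra_isAlgebra.Build k bosonization bos_scaleAr.

Definition bos_comul (t : bosonization) : tens bosonization bosonization :=
  \sw_(x, h <- t) \sw_(x1, x2 <- comul x) \sw_(g, x20 <- coact x2)
    \sw_(h1, h2 <- comul h) ((x1 \ox (g * h1) : bosonization) \ox (x20 \ox h2 : bosonization)).
Fact bos_comul_lin : islin (fun t : tens B H => bos_comul t).
Proof. rewrite /bos_comul; lin. Qed.
Lemma bos_comulE x h : bos_comul (x \ox h) =
  \sw_(x1, x2 <- comul x) \sw_(g, x20 <- coact x2)
    \sw_(h1, h2 <- comul h) ((x1 \ox (g * h1) : bosonization) \ox (x20 \ox h2 : bosonization)).
Proof. rewrite /bos_comul swe_tensor //; lin. Qed.

Lemma sw_bos_comul (X : lmodType k) (f : bosonization -> bosonization -> X) x h :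
  bilin f ->
  (\sw_(P, Q <- bos_comul (x \ox h)) f P Q) =
  \sw_(x1, x2 <- comul x) \sw_(g, x20 <- coact x2)
    \sw_(h1, h2 <- comul h) f (x1 \ox (g * h1)) (x20 \ox h2).
Proof.
move=> Hf; rewrite bos_comulE.
rewrite sw_nest //; apply: eq_sw => x1 x2.
rewrite sw_nest //; apply: eq_sw => g x20.
rewrite sw_nest //; apply: eq_sw => h1 h2.
by rewrite swe_tensor.
Qed.

Fact bos_comulA (t : bosonization) :
    (\sw_(a, b <- bos_comul t) \sw_(a1, a2 <- bos_comul a) a1 \ox (a2 \ox b)) =
    (\sw_(a, b <- bos_comul t) \sw_(b1, b2 <- bos_comul b) a \ox (b1 \ox b2)).
Proof.
have bl : bilin (fun a b : bosonization => \sw_(a1, a2 <- bos_comul a) a1 \ox (a2 \ox b)).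
  apply: islin_bilin => [b|a]; last by lin.
  apply: (islin_comp (g := fun t => \sw_(a1, a2 <- t) a1 \ox (a2 \ox b))); last exact: bos_comul_lin.
  by lin.
have br : bilin (fun a b : bosonization => \sw_(b1, b2 <- bos_comul b) a \ox (b1 \ox b2)).
  apply: islin_bilin => [b|a]; first by lin.
  apply: (islin_comp (g := fun t => \sw_(a1, a2 <- t) a \ox (a1 \ox a2))); last exact: bos_comul_lin.
  by lin.
apply: (tens_ext
   (f := fun t => (\sw_(a, b <- bos_comul t) \sw_(a1, a2 <- bos_comul a) a1 \ox (a2 \ox b)))
   (g := fun t => (\sw_(a, b <- bos_comul t) \sw_(b1, b2 <- bos_comul b) a \ox (b1 \ox b2)))).
- by apply: (islin_comp (swe_linear bl)) bos_comul_lin.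
- by apply: (islin_comp (swe_linear br)) bos_comul_lin.
move=> x h.
rewrite !sw_bos_comul //.
pose K (x1 a0 b0 : B) (p g1 g2 h1 h21 h22 : H) :=
  (x1 \ox (p * g1 * h1) : bosonization) \ox
    ((a0 \ox (g2 * h21) : bosonization) \ox (b0 \ox h22 : bosonization)).
transitivity (\sw_(x1, x2 <- comul x) \sw_(a, b <- comul x2) \sw_(p, a0 <- coact a)
  \sw_(g, b0 <- coact b) \sw_(g1, g2 <- comul g) \sw_(h1, h2 <- comul h)
  \sw_(h21, h22 <- comul h2) K x1 a0 b0 p g1 g2 h1 h21 h22).
- rewrite -(sw_comulA (f := fun x1 a b => \sw_(p, a0 <- coact a)
  \sw_(g, b0 <- coact b) \sw_(g1, g2 <- comul g) \sw_(h1, h2 <- comul h)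
  \sw_(h21, h22 <- comul h2) K x1 a0 b0 p g1 g2 h1 h21 h22)); last by rewrite /K; trilin.
  apply: eq_sw => x1 x2.
  transitivity (\sw_(g, x20 <- coact x2) \sw_(h1, h2 <- comul h)
    \sw_(a1, a2 <- comul x1) \sw_(p, a20 <- coact a2) \sw_(g1, g2 <- comul g)
    \sw_(h11, h12 <- comul h1) K a1 a20 x20 p g1 g2 h11 h12 h2).
    apply: eq_sw => g x20; apply: eq_sw => h1 h2.
    rewrite sw_bos_comul; last by lin.
    apply: eq_sw => a1 a2; apply: eq_sw => p a20.
    rewrite sw_comulM; last by lin.
    by apply: eq_sw => g1 g2; apply: eq_sw => h11 h12; rewrite /K mulrA.
  under eq_sw => g x20 do rewrite sw_swap.
  rewrite sw_swap; apply: eq_sw => a1 a2.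
  under eq_sw => g x20 do rewrite sw_swap.
  rewrite sw_swap; apply: eq_sw => p a20.
  apply: eq_sw => g x20; rewrite sw_swap; apply: eq_sw => g1 g2.
  apply: (sw_comulA (f := fun a b c => K a1 a20 x20 p g1 g2 a b c)).
  by rewrite /K; trilin.
- apply: eq_sw => x1 x2; symmetry.
  pose F g y1 y2 := \sw_(h1, h2 <- comul h) \sw_(q, y20 <- coact y2)
    \sw_(h21, h22 <- comul h2)
    (x1 \ox (g * h1) : bosonization) \ox
    ((y1 \ox (q * h21) : bosonization) \ox (y20 \ox h22 : bosonization)).
  transitivity (\sw_(g, x20 <- coact x2) \sw_(y1, y2 <- comul x20) F g y1 y2).
    apply: eq_sw => g x20; rewrite /F sw_swap; apply: eq_sw => h1 h2.
    by rewrite sw_bos_comul //; lin.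
  rewrite sw_comul_coact; last by rewrite /F; trilin.
  apply: eq_sw => a b; apply: eq_sw => p a0.
  rewrite (sw_coactA (f := fun g1 g2 b0 => \sw_(h1, h2 <- comul h)
     \sw_(h21, h22 <- comul h2) K x1 a0 b0 p g1 g2 h1 h21 h22)); last by rewrite /K; trilin.
  by apply: eq_sw => g b0; rewrite /F sw_swap.
Qed.

Fact bos_counit_linear : linear_for *%R (bos_counit : bosonization -> k).
Proof. exact: bos_counit_lin. Qed.
HB.instance Definition _ := GRing.isLinear.Build k bosonization k *%R _ bos_counit_linear.
Fact bos_comul_linear : linear bos_comul.
Proof. exact: bos_comul_lin. Qed.
HB.instance Definition _ := GRing.isLinear.Build k bosonization (tens bosonization bosonization) *:%R _ bos_comul_linear.

Fact bos_counitl (c : bosonization) : (\sw_(a, b <- bos_comul c) (bos_counit a : k) *: b) = c.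
Proof.
have bl : bilin (fun a b : bosonization => (bos_counit a : k) *: b).
  by apply: islin_bilin => [b|a]; [apply: (islin_scalel b bos_counit_lin) | lin].
apply: (tens_ext
   (f := fun t => \sw_(a, b <- bos_comul t) (bos_counit a : k) *: b) (g := fun t => t)).
- by apply: (islin_comp (swe_linear bl)) bos_comul_lin.
- by lin.
move=> x h; rewrite sw_bos_comul //.
transitivity (\sw_(x1, x2 <- comul x) counit x1 *: \sw_(g, x20 <- coact x2)
   counit g *: \sw_(h1, h2 <- comul h) counit h1 *: (x20 \ox h2)).
  apply: eq_sw => x1 x2; rewrite (sw_apply _ _ (islin_scaler _ (@islin_id _ _))).
  apply: eq_sw => g x20; rewrite !(sw_apply _ _ (islin_scaler _ (@islin_id _ _))).
  by apply: eq_sw => h1 h2; rewrite bos_counitE counitM !scalerA mulrA.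
rewrite sw_counitl; last by lin.
rewrite (sw_coact1 (f := fun x20 => \sw_(h1, h2 <- comul h) counit h1 *: (x20 \ox h2))); last by lin.
by rewrite (sw_counitl (f := fun h => x \ox h)) //; lin.
Qed.

Fact bos_counitr (c : bosonization) : (\sw_(a, b <- bos_comul c) (bos_counit b : k) *: a) = c.
Proof.
have bl : bilin (fun a b : bosonization => (bos_counit b : k) *: a).
  by apply: islin_bilin => [b|a]; [lin | apply: (islin_scalel a bos_counit_lin)].
apply: (tens_ext
   (f := fun t => \sw_(a, b <- bos_comul t) (bos_counit b : k) *: a) (g := fun t => t)).
- by apply: (islin_comp (swe_linear bl)) bos_comul_lin.
- by lin.
move=> x h; rewrite sw_bos_comul //.
transitivity (\sw_(x1, x2 <- comul x) \sw_(g, x20 <- coact x2)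
   (counit x20 : k) *: \sw_(h1, h2 <- comul h) counit h2 *: (x1 \ox (g * h1))).
  apply: eq_sw => x1 x2; apply: eq_sw => g x20.
  rewrite !(sw_apply _ _ (islin_scaler _ (@islin_id _ _))).
  by apply: eq_sw => h1 h2; rewrite bos_counitE !scalerA.
under eq_sw => x1 x2.
  rewrite (sw_counit_coact (f := fun g => \sw_(h1, h2 <- comul h) counit h2 *: (x1 \ox (g * h1)))); last by lin.
  over.
rewrite (sw_counitr (f := fun x1 => (\sw_(h1,h2 <- comul h) counit h2 *: (x1 \ox (1 * h1))))); last by lin.
by rewrite (sw_counitr (f := fun h => x \ox (1 * h))) ?mul1r //; lin.
Qed.

HB.instance Definition _ := isCoalgebra.Build k bosonization
  bos_comulA bos_counitl bos_counitr.

Lemma bosE (x y : B) (h h' : H) :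
  (x \ox h : bosonization) * (y \ox h' : bosonization) =
  \sw_(h1, h2 <- comul h) (x * act h1 y) \ox (h2 * h') :> bosonization.
Proof. exact: bos_mulE. Qed.

Lemma bos_ext (X : lmodType k) (f g : bosonization -> X) (t : bosonization) :
  islin f -> islin g ->
  (forall x h, f (x \ox h) = g (x \ox h)) -> f t = g t.
Proof. by move=> Hf Hg E; apply: (tens_ext (f := f) (g := g)). Qed.

Lemma sw_comulB (X : lmodType k) (f : bosonization -> bosonization -> X) x h :
  bilin f ->
  (\sw_(P, Q <- comul (x \ox h : bosonization)) f P Q) =
  \sw_(x1, x2 <- comul x) \sw_(g, x20 <- coact x2)
    \sw_(h1, h2 <- comul h) f (x1 \ox (g * h1)) (x20 \ox h2).
Proof. exact: sw_bos_comul. Qed.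

Fact bos_comul1 : comul (1 : bosonization) = 1 \ox 1.
Proof.
rewrite [LHS]bos_comulE comul_one swe_tensor; last by lin.
rewrite coact_one swe_tensor; last by lin.
rewrite comul1 swe_tensor; last by lin.
by rewrite mulr1.
Qed.

Fact bos_counit1 : counit (1 : bosonization) = 1.
Proof. by rewrite [LHS]bos_counitE counit_one counit1 mulr1. Qed.

Fact bos_counitM (x y : bosonization) : counit (x * y) = counit x * counit y.
Proof.
have l1 (z : bosonization) : islin (fun x => counit (x * z) : k^o).
  by move=> a u v; rewrite mulrDl -scalerAl linearP.
have l2 (z : bosonization) : islin (fun x => counit (z * x) : k^o).
  by move=> a u v; rewrite mulrDr -scalerAr linearP.
have l3 (z : k) : islin (fun x : bosonization => counit x * z : k^o).
  by move=> a u v; rewrite linearP /= mulrDl -mulrA.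
have l4 (z : k) : islin (fun x : bosonization => z * counit x : k^o).
  by move=> a u v; rewrite linearP /= mulrDr mulrCA.
apply: (bos_ext (f := fun x => counit (x * y) : k^o) (g := fun x => counit x * counit y : k^o)) => // {}x h.
apply: (bos_ext (f := fun y => counit ((x \ox h : bosonization) * y) : k^o) (g := fun y => counit (x \ox h : bosonization) * counit y : k^o)) => // {}y h'.
rewrite bosE (sw_apply (Y := k^o) _ _ (islin_scalar (counit : {scalar bosonization}))).
rewrite [counit (x \ox h : bosonization)]bos_counitE [counit (y \ox h' : bosonization)]bos_counitE.
transitivity (\sw_(h1, h2 <- comul h) counit h1 *: (counit x * counit y * counit h2 * counit h' : k^o)).
  apply: eq_sw => h1 h2.
  rewrite [LHS]bos_counitE counitM counit_mul counit_act /GRing.scale /=.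
  by rewrite [counit x * (counit h1 * _)]mulrCA -!mulrA.
rewrite (sw_counitl (X := k^o) (f := fun h2 => counit x * counit y * counit h2 * counit h' : k^o)).
  by rewrite !mulrA; congr (_ * _); rewrite -!mulrA; congr (_ * _); rewrite mulrC.
by lin.
Qed.

Lemma sw_comul_braided (X : lmodType k) (f : B -> B -> X) (x y : B) : bilin f ->
  (\sw_(a, b <- comul (x * y)) f a b) =
  \sw_(x1, x2 <- comul x) \sw_(y1, y2 <- comul y) \sw_(g, x20 <- coact x2)
      f (x1 * act g y1) (x20 * y2).
Proof.
move=> Hf; rewrite comul_braided sw_nest //; apply: eq_sw => a b.
rewrite sw_nest //; apply: eq_sw => c d; rewrite sw_nest //; apply: eq_sw => ? ?.
by rewrite swe_tensor.
Qed.
Lemma sw_comul_act (X : lmodType k) (f : B -> B -> X) (h : H) (x : B) : bilin f ->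
  (\sw_(a, b <- comul (act h x)) f a b) =
  \sw_(h1, h2 <- comul h) \sw_(x1, x2 <- comul x) f (act h1 x1) (act h2 x2).
Proof.
move=> Hf; rewrite comul_act sw_nest //; apply: eq_sw => a b.
by rewrite sw_nest //; apply: eq_sw => c d; rewrite swe_tensor.
Qed.
Lemma sw_coact_mul (X : lmodType k) (f : H -> B -> X) (x y : B) : bilin f ->
  (\sw_(a, b <- coact (x * y)) f a b) =
  \sw_(g, x0 <- coact x) \sw_(g', y0 <- coact y) f (g * g') (x0 * y0).
Proof.
move=> Hf; rewrite coact_mul sw_nest //; apply: eq_sw => a b.
by rewrite sw_nest //; apply: eq_sw => c d; rewrite swe_tensor.
Qed.

Fact bos_comulM (s t : bosonization) : comul (s * t) =
  \sw_(x1, x2 <- comul s) \sw_(y1, y2 <- comul t) (x1 * y1) \ox (x2 * y2).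
Proof.
have linp1 (p : bosonization) : islin (fun t : bosonization => comul (p * t)) by lin.
have linp3 (p r : bosonization) : bilin (fun P Q : bosonization => (p * P) \ox (r * Q)) by lin.
have linp2 (p : bosonization) : islin (fun t : bosonization => \sw_(x1, x2 <- comul p) \sw_(y1, y2 <- comul t) (x1 * y1) \ox (x2 * y2)) by lin; exact: bos_comul_lin.
apply: (bos_ext (f := fun s => comul (s * t))
  (g := fun s => \sw_(x1, x2 <- comul s) \sw_(y1, y2 <- comul t) (x1 * y1) \ox (x2 * y2))).
- by lin.
- by lin.
move=> x h; apply: (bos_ext (f := fun t => comul ((x \ox h : bosonization) * t))
  (g := fun t => \sw_(x1, x2 <- comul (x \ox h : bosonization)) \sw_(y1, y2 <- comul t) (x1 * y1) \ox (x2 * y2))).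
- exact: linp1.
- exact: linp2.
move=> y l.
rewrite bosE (sw_apply _ _ (islin_linear _)).
pose K (a b : B) (p q : H) (c d : B) (r m : H) :=
  (a * b \ox (p * q) : bosonization) \ox (c * d \ox (r * m) : bosonization).
transitivity (\sw_(x1, x2 <- comul x) \sw_(y1, y2 <- comul y) \sw_(g, x20 <- coact x2)
  \sw_(g1, g2 <- comul g) \sw_(l1, l2 <- comul l) \sw_(h1, h' <- comul h)
  \sw_(h2, h3 <- comul h') \sw_(h21, h22 <- comul h2) \sw_(q, y20 <- coact y2)
  K x1 (act g1 (act h1 y1)) g2 (h21 * q * l1) x20 (act h22 y20) h3 l2).
- pose K2 x1 x2 y1 y2 a b c := \sw_(g, x20 <- coact x2)
  \sw_(g1, g2 <- comul g) \sw_(l1, l2 <- comul l)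
  \sw_(q, z <- coact (act b y2)) \sw_(h21, h22 <- comul c)
  K x1 (act g1 (act a y1)) g2 (q * (h21 * l1)) x20 z h22 l2.
  transitivity (\sw_(h1, h2 <- comul h) \sw_(h11, h12 <- comul h1)
    \sw_(x1, x2 <- comul x) \sw_(y1, y2 <- comul y) K2 x1 x2 y1 y2 h11 h12 h2).
    apply: eq_sw => h1 h2; rewrite [LHS]bos_comulE.
    rewrite sw_comul_braided; last by lin.
    under eq_sw => x1 x2.
      rewrite sw_comul_act; last by lin.
      over.
    rewrite [RHS]sw_swap; apply: eq_sw => x1 x2.
    apply: eq_sw => h11 h12; apply: eq_sw => y1 y2.
    rewrite /K2.
    transitivity (\sw_(g, x20 <- coact x2) \sw_(g', x0 <- coact x20)
      \sw_(l1, l2 <- comul l) \sw_(q, z <- coact (act h12 y2))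
      \sw_(h21, h22 <- comul h2)
      K x1 (act g (act h11 y1)) g' (q * (h21 * l1)) x0 z h22 l2); last first.
      symmetry; apply: (sw_coactA (f := fun g1 g2 x20 => \sw_(l1, l2 <- comul l)
        \sw_(q, z <- coact (act h12 y2)) \sw_(h21, h22 <- comul h2)
        K x1 (act g1 (act h11 y1)) g2 (q * (h21 * l1)) x20 z h22 l2)).
      by rewrite /K; trilin.
    apply: eq_sw => g x20; rewrite sw_coact_mul; last by lin.
    apply: eq_sw => g' x0; rewrite [RHS]sw_swap; apply: eq_sw => q z.
    rewrite sw_comulM; last by lin.
    rewrite sw_swap; apply: eq_sw => l1 l2; apply: eq_sw => h21 h22.
    by rewrite /K !mulrA.
  rewrite /K2.
  under eq_sw => h1 h2 do rewrite sw_swap; rewrite sw_swap; apply: eq_sw => x1 x2.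
  under eq_sw => h1 h2 do rewrite sw_swap; rewrite sw_swap; apply: eq_sw => y1 y2.
  under eq_sw => h1 h2 do rewrite sw_swap; rewrite sw_swap; apply: eq_sw => g x20.
  under eq_sw => h1 h2 do rewrite sw_swap; rewrite sw_swap; apply: eq_sw => g1 g2.
  under eq_sw => h1 h2 do rewrite sw_swap; rewrite sw_swap; apply: eq_sw => m1 m2.
  rewrite (sw_comulA (f := fun a b c => \sw_(q, z <- coact (act b y2))
    \sw_(h21, h22 <- comul c)
     K x1 (act g1 (act a y1)) g2 (q * (h21 * m1)) x20 z h22 m2)); last by rewrite /K; trilin.
  apply: eq_sw => h1 h'.
  under [RHS]eq_sw => h2 h3.
    rewrite (sw_act_coact (f := fun r w => K x1 (act g1 (act h1 y1)) g2 (r * m1) x20 w h3 m2));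
      last by rewrite /K; lin.
    over.
  rewrite (sw_comulA (f := fun a b c => \sw_(q, w <- coact (act a y2))
    K x1 (act g1 (act h1 y1)) g2 (q * b * m1) x20 w c m2)); last by rewrite /K; trilin.
  apply: eq_sw => b c; rewrite sw_swap; apply: eq_sw => h21 h22; apply: eq_sw => q z.
  by rewrite mulrA.
- rewrite sw_comulB; last by lin; exact: bos_comul_lin.
  apply: eq_sw => x1 x2.
  transitivity (\sw_(g, x20 <- coact x2) \sw_(h1, h2 <- comul h)
    \sw_(y1, y2 <- comul y) \sw_(q, y20 <- coact y2) \sw_(l1, l2 <- comul l)
    \sw_(g1, g2 <- comul g) \sw_(h11, h12 <- comul h1) \sw_(h21, h22 <- comul h2)
    K x1 (act g1 (act h11 y1)) g2 (h12 * q * l1) x20 (act h21 y20) h22 l2); last first.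
    apply: eq_sw => g x20; apply: eq_sw => h1 h2; rewrite sw_comulB; last exact: linp3.
    apply: eq_sw => y1 y2; apply: eq_sw => q y20; apply: eq_sw => m1 m2.
    rewrite !bosE sw_comulM; last by lin.
    rewrite (sw_apply _ _ (g := fun u : bosonization => u \ox _)); last by lin.
    apply: eq_sw => g1 g2.
    rewrite (sw_apply _ _ (g := fun u : bosonization => u \ox _)); last by lin.
    apply: eq_sw => h11 h12.
    rewrite (sw_apply _ _ (g := fun u : bosonization => _ \ox u)); last by lin.
    by apply: eq_sw => h21 h22; rewrite /K actM !mulrA.
  rewrite sw_swap.
  apply: eq_sw => g x20; rewrite [RHS]sw_swap; apply: eq_sw => y1 y2.
  under [RHS]eq_sw => h1 h2 do rewrite sw_swap.
  rewrite sw_swap [RHS]sw_swap; apply: eq_sw => m1 m2.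
  under [RHS]eq_sw => h1 h2 do rewrite sw_swap.
  rewrite [RHS]sw_swap; apply: eq_sw => g1 g2.
  transitivity (\sw_(h1, h2 <- comul h) \sw_(h11, h12 <- comul h1)
    \sw_(h21, h22 <- comul h2) \sw_(q, y20 <- coact y2)
    K x1 (act g1 (act h11 y1)) g2 (h12 * q * m1) x20 (act h21 y20) h22 m2); last first.
    apply: eq_sw => h1 h2; rewrite [RHS]sw_swap; apply: eq_sw => h11 h12.
    by rewrite sw_swap.
  rewrite (sw_comulA (f := fun a b c => \sw_(h21, h22 <- comul c) \sw_(q, y20 <- coact y2)
    K x1 (act g1 (act a y1)) g2 (b * q * m1) x20 (act h21 y20) h22 m2)); last by rewrite /K; trilin.
  apply: eq_sw => h1 h'.
  apply: (sw_comulA (f := fun a b c => \sw_(q, y20 <- coact y2)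
    K x1 (act g1 (act h1 y1)) g2 (a * q * m1) x20 (act b y20) c m2)).
  by rewrite /K; trilin.
Qed.

HB.instance Definition _ := isBialgebra.Build k bosonization
  bos_comul1 bos_comulM bos_counit1 bos_counitM.
End Bos.

Section Statements.
Variable k : fieldType.

(* Every left ideal of A has a complementary left ideal, i.e. the left
   regular module is semisimple. *)
Definition left_ideal (A : algType k) (I : A -> Prop) : Prop :=
  [/\ I 0, forall x y, I x -> I y -> I (x + y) & forall a x, I x -> I (a * x)].

Definition semisimple (A : algType k) : Prop :=
  forall I : A -> Prop, left_ideal I ->
  exists J : A -> Prop, [/\ left_ideal J,
    forall x, exists y z, [/\ I y, J z & x = y + z] &
    forall x, I x -> J x -> x = 0].

Definition two_sided_ideal (A : algType k) (I : A -> Prop) : Prop :=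
  [/\ I 0, forall x y, I x -> I y -> I (x + y) &
      forall a x b, I x -> I (a * x * b)].

Definition ideal_generated (A : algType k) (G : A -> Prop) (x : A) : Prop :=
  forall I : A -> Prop, two_sided_ideal I -> (forall y, G y -> I y) -> I x.

(* [comul x] lies in I (x) C + C (x) I. *)
Definition coideal (C : coalgType k) (I : C -> Prop) : Prop :=
  forall x, I x -> counit x = 0 /\
    exists s r : seq (C * C),
      [/\ forall p, p \in s -> I p.1, forall p, p \in r -> I p.2 &
          comul x = \sum_(p <- s) (p.1 \ox p.2) + \sum_(p <- r) (p.1 \ox p.2)].

(* [homog iota n] is the span of the n-fold products of elements of V: this is
   the degree n component both of T(V) and of the Nichols algebra. *)
Definition homog (V : lmodType k) (R : algType k) (iota : V -> R) (n : nat)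
    (x : R) : Prop :=
  exists s : seq (k * n.-tuple V),
    x = \sum_(p <- s) p.1 *: \prod_(v <- p.2) iota v.

Variable H : hopfType k.

Definition braiding (V : ydType H) (t : tens V V) : tens V V :=
  \sw_(x, y <- t) \sw_(g, x0 <- coact x) act g y \ox x0.

Definition symmetric_braiding (V : ydType H) : Prop :=
  forall t : tens V V, braiding (braiding t) = t.

Definition yd_morphism (V W : ydType H) (f : V -> W) : Prop :=
  (forall h v, f (act (h : H) v) = act h (f v)) /\
  (forall v, coact (f v) = \sw_(g, w <- coact v) (g : H) \ox f w).

Section Nichols.
Variable V : ydType H.

(* T is the free algebra on V, with the braided bialgebra structure for which V
   is a Yetter-Drinfeld submodule consisting of primitive elements. This
   determines (T, iota) up to a unique isomorphism. *)
Definition is_tensor_algebra (T : braidedBialgType H) (iota : {linear V -> T}) :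
    Prop :=
  [/\ forall (C : algType k) (f : {linear V -> C}),
        exists2 g : {lrmorphism T -> C}, (forall v, g (iota v) = f v) &
          forall g' : {lrmorphism T -> C}, (forall v, g' (iota v) = f v) ->
            forall t, g' t = g t,
      yd_morphism iota,
      forall v, comul (iota v) = iota v \ox 1 + 1 \ox iota v &
      forall v, counit (iota v) = 0].

Definition nichols_candidate (T : braidedBialgType H) (iota : V -> T)
    (I : T -> Prop) : Prop :=
  (exists2 G : T -> Prop,
     forall y, G y -> exists2 n : nat, (2 <= n)%N & homog iota n y &
     forall x, I x <-> ideal_generated G x) /\
  coideal I.

Definition braided_bialgebra_morphism (R S : braidedBialgType H)
    (f : {lrmorphism R -> S}) : Prop :=
  [/\ yd_morphism f,
      forall x, comul (f x) = \sw_(x1, x2 <- comul x) f x1 \ox f x2 &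
      forall x, counit (f x) = counit x].

(* B = T(V)/I(V) with I(V) the largest homogeneous two-sided ideal generated in
   degrees >= 2 that is a coideal. *)
Definition is_nichols_algebra (B : braidedBialgType H) (iota : {linear V -> B}) :
    Prop :=
  exists (T : braidedBialgType H) (j : {linear V -> T}) (pi : {lrmorphism T -> B}),
    [/\ is_tensor_algebra j,
        braided_bialgebra_morphism pi /\ (forall v, pi (j v) = iota v),
        forall b, exists t, pi t = b,
        nichols_candidate j (fun t => pi t = 0) &
        forall I, nichols_candidate j I -> forall t, I t -> pi t = 0].

Definition H_invariant (eta : {scalar (tens V V)}) : Prop :=
  forall (h : H) (x y : V),
    (\sw_(h1, h2 <- comul h) (eta (act h1 x \ox act h2 y) : k^o)) =
    counit h * eta (x \ox y).

Variables (B : braidedBialgType H) (iota : {linear V -> B}).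
Local Notation A := (bosonization B).

Definition bos_homog (n : nat) (a : A) : Prop :=
  exists2 s : seq (B * H), forall p, p \in s -> homog iota n p.1 &
    a = \sum_(p <- s) (p.1 \ox p.2).

(* These conditions determine [etat], since B is spanned by its homogeneous
   components. *)
Definition is_eta_tilde (eta : {scalar (tens V V)}) (etat : {scalar (tens A A)}) :
    Prop :=
  (forall m n (a b : A), bos_homog m a -> bos_homog n b ->
     (m, n) != (1, 1)%N -> etat (a \ox b) = 0) /\
  (forall (x y : V) (h h' : H),
     etat ((iota x \ox h : A) \ox (iota y \ox h' : A)) =
     eta (x \ox act h y) * counit h').

End Nichols.
End Statements.

Section Cocycle.
Variables (k : fieldType) (A : bialgType k).

Definition conv (f g : tens A A -> k) (t : tens A A) : k :=
  \sw_(a, b <- t) \sw_(a1, a2 <- comul a) \sw_(b1, b2 <- comul b)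
    (f (a1 \ox b1) * g (a2 \ox b2) : k^o).

Definition conv1 (t : tens A A) : k :=
  \sw_(a, b <- t) (counit a * counit b : k^o).

Definition conv_pow (f : tens A A -> k) (n : nat) : tens A A -> k :=
  iter n (conv f) conv1.

(* s = \sum_i f^{*i} / i!, a sum with finitely many nonzero terms at each t. *)
Definition is_conv_exp (f s : tens A A -> k) : Prop :=
  forall t, exists N : nat, forall M : nat, (N <= M)%N ->
    s t = \sum_(i < M) (i`!%:R)^-1 * conv_pow f i t.

Definition multiplicative_2cocycle (sigma : {scalar (tens A A)}) : Prop :=
  [/\ exists tau : {scalar (tens A A)},
        conv sigma tau =1 conv1 /\ conv tau sigma =1 conv1,
      forall a b c : A,
        (\sw_(b1, b2 <- comul b) \sw_(c1, c2 <- comul c)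
           (sigma (b1 \ox c1) * sigma (a \ox (b2 * c2)) : k^o)) =
        (\sw_(a1, a2 <- comul a) \sw_(b1, b2 <- comul b)
           (sigma (a1 \ox b1) * sigma ((a2 * b2) \ox c) : k^o)) &
      forall a : A, sigma (a \ox 1) = counit a /\ sigma (1 \ox a) = counit a].

End Cocycle.

(* Main.v *)
Require Import Defs.
From HB Require Import structures.
From mathcomp Require Import all_boot all_order all_algebra.
From mathcomp Require Import boolp zify.
Set Implicit Arguments. Unset Strict Implicit. Unset Printing Implicit Defensive.
Import GRing.Theory.
Local Open Scope ring_scope.

(** Write A for the bosonization and call a functional on a coalgebra locally
    nilpotent when, at each point, its large convolution powers vanish.

    Linear functionals on a coalgebra form a ring under convolution, and a
    locally nilpotent functional has an exponential there; exponentials of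
    commuting functionals multiply ([is_expD]) and exponentials commute with
    pull-back along coalgebra maps ([is_exp_pull]). Let eta' be a functional on
    A (x) A. Pulling it back to A (x) A (x) A along the four coalgebra maps
    eps (x) id (x) id, id (x) mul, id (x) id (x) eps and mul (x) id gives J1, J2,
    J3 and J4. Both sides of the 2-cocycle condition for sigma = exp eta' are
    products of pulled back exponentials: exp J1 * exp J2 on the left and
    exp J3 * exp J4 on the right. Hence the condition holds as soon as J1
    commutes with J2, J3 commutes with J4, and J1 + J2 = J3 + J4, that is,
    eta' is a Hochschild 2-cocycle ([exp_cocycle]).

    For eta' = eta tilde these three facts are checked on words x1 ... xn # h,
    which span A. The functional eta tilde lives in bidegree (1,1); it is
    balanced over H, because eta is H-invariant, and these two properties give
    the Hochschild identity ([E_hochschild]). They also leave only finitely many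
    degrees in which the commutators could be nonzero: (1,1,2) and (1,2,1) for
    J1 and J2, (1,2,1) and (2,1,1) for J3 and J4. There only the (1,1)-component
    of the coproduct of a product of two primitive elements contributes, and
    the commutation reduces to two identities about eta and the braiding
    ([eta_slide] and [eta_slide2]). Both follow from c^2 = id: writing the
    argument as a braided tensor turns one side into a coproduct of H acting
    diagonally, which invariance of eta removes.

    On words the convolution powers of eta tilde vanish beyond the length of the
    word, so the exponential exists ([E_nilpotent]). The existence of eta tilde
    itself needs a projection of the Nichols algebra onto V killing all other
    degrees. It is obtained from the map of the free algebra to the square-zero
    extension of k by V, which kills everything of degree at least two, hence
    the Nichols ideal ([nichols_proj]). *)

(** * The convolution ring of a coalgebra *)

Lemma eq_swk (k : fieldType) (U W : lmodType k) (t : tens U W) (f g : U -> W -> k^o) :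
  (forall a b, f a b = g a b) -> (\sw_(a, b <- t) f a b) = \sw_(a, b <- t) g a b.
Proof. exact: eq_sw. Qed.

Section Dual.
Variables (k : fieldType) (C : coalgType k).

(** A nontrivial ring structure would need a nonzero counit, so only the
    weaker ring structure that allows 1 = 0 is put on this type. *)
Record dual := Dual { dval :> C -> k; dvalP : islin (dval : C -> k^o) }.

Lemma dual_ext (f g : dual) : f =1 g -> f = g.
Proof.
case: f g => f Hf [g Hg] /= E; have {E} E : f = g by apply/funext.
by case: g / E Hg => Hg; congr Dual; exact: Prop_irrelevance.
Qed.

HB.instance Definition _ := gen_eqMixin dual.
HB.instance Definition _ := gen_choiceMixin dual.

Fact dual_zeroP : islin (fun _ : C => 0 : k^o).
Proof. by move=> a x y; rewrite scaler0 addr0. Qed.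
Fact dual_addP (f g : dual) : islin (fun x => f x + g x : k^o).
Proof. by move=> a x y; rewrite !dvalP scalerDr addrACA. Qed.
Fact dual_oppP (f : dual) : islin (fun x => - f x : k^o).
Proof. by move=> a x y; rewrite dvalP opprD scalerN. Qed.

Lemma dval_bilin (D : lmodType k) (f : D -> C) (g : dual) :
  islin f -> islin (fun x => g (f x) : k^o).
Proof. exact: (islin_comp (@dvalP g)). Qed.

Fact dual_mulP (f g : dual) :
  islin (fun c => \sw_(a, b <- comul c) (f a * g b : k^o)).
Proof. by lin; apply: dvalP. Qed.
Fact dual_oneP : islin (fun c : C => counit c : k^o).
Proof. by lin. Qed.

Definition dual_zero := Dual dual_zeroP.
Definition dual_add f g := Dual (dual_addP f g).
Definition dual_opp f := Dual (dual_oppP f).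
Definition dual_one := Dual dual_oneP.
Definition dual_mul f g := Dual (dual_mulP f g).

Fact dual_addA : associative dual_add.
Proof. by move=> f g h; apply: dual_ext => c /=; rewrite addrA. Qed.
Fact dual_addC : commutative dual_add.
Proof. by move=> f g; apply: dual_ext => c /=; rewrite addrC. Qed.
Fact dual_add0 : left_id dual_zero dual_add.
Proof. by move=> f; apply: dual_ext => c /=; rewrite add0r. Qed.
Fact dual_addN : left_inverse dual_zero dual_opp dual_add.
Proof. by move=> f; apply: dual_ext => c /=; rewrite addNr. Qed.
HB.instance Definition _ :=
  GRing.isZmodule.Build dual dual_addA dual_addC dual_add0 dual_addN.

Fact dual_mulA : associative dual_mul.
Proof.
move=> f g h; apply: dual_ext => c /=.
transitivity (\sw_(a, b <- comul c) \sw_(b1, b2 <- comul b) (f a * (g b1 * h b2) : k^o)).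
  apply: eq_swk => a b; apply: (sw_apply (g := fun y : k^o => f a * y : k^o)).
  by apply: islin_kmulr.
rewrite -(sw_comulA (f := fun a b d => f a * (g b * h d) : k^o)); last first.
  by trilin; apply: dvalP.
apply: eq_swk => a b; rewrite (sw_apply (g := fun y : k^o => y * h b : k^o)).
  by apply: eq_swk => a1 a2; rewrite mulrA.
by apply: islin_kmull.
Qed.
Fact dual_mul1l : left_id dual_one dual_mul.
Proof. by move=> f; apply: dual_ext => c /=; exact: (sw_counitl c (@dvalP f)). Qed.
Fact dual_mul1r : right_id dual_one dual_mul.
Proof.
move=> f; apply: dual_ext => c /=; rewrite -[RHS](sw_counitr c (@dvalP f)).
by apply: eq_swk => a b; rewrite mulrC.
Qed.
Fact dual_mulDl : left_distributive dual_mul +%R.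
Proof.
move=> f g h; apply: dual_ext => c /=; rewrite !swe_sumE -big_split.
by apply: eq_bigr => p _; rewrite /= mulrDl.
Qed.
Fact dual_mulDr : right_distributive dual_mul +%R.
Proof.
move=> f g h; apply: dual_ext => c /=; rewrite !swe_sumE -big_split.
by apply: eq_bigr => p _; rewrite /= mulrDr.
Qed.
HB.instance Definition _ := GRing.Zmodule_isPzRing.Build dual
  dual_mulA dual_mul1l dual_mul1r dual_mulDl dual_mulDr.

Lemma dval_add (f g : dual) c : (f + g) c = f c + g c. Proof. by []. Qed.
Lemma dval_mul (f g : dual) c :
  (f * g) c = \sw_(a, b <- comul c) (f a * g b : k^o).
Proof. by []. Qed.
Lemma dval_mulE (f g : dual) c :
  (f * g) c = \sum_(p <- repr (comul c)) f p.1 * g p.2.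
Proof. by []. Qed.
Lemma dval_mulrn (f : dual) n c : (f *+ n) c = f c *+ n.
Proof. by elim: n => // n IH; rewrite !mulrS dval_add IH. Qed.
Lemma dval_sum n (F : 'I_n -> dual) c :
  (\sum_(i < n) F i) c = \sum_(i < n) F i c.
Proof.
elim: n F => [|n IH] F; first by rewrite !big_ord0.
by rewrite !big_ord_recl dval_add IH.
Qed.

Fact dval_linear (f : dual) : linear_for *%R (dval f : C -> k).
Proof. exact: dvalP. Qed.
Definition dual_scalar (f : dual) : {scalar C} :=
  HB.pack (dval f : C -> k) (GRing.isLinear.Build _ _ _ _ _ (dval_linear f)).
Definition scalar_dual (f : {scalar C}) : dual := Dual (islin_scalar f).

End Dual.

(** * Exponentials in the convolution ring *)

Section Esum.
Variable k : fieldType.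

(** A sum with finitely many nonzero terms, as a relation: the partial sums are
    eventually constant. *)
Definition esum_to (u : nat -> k) (S : k) :=
  exists N, forall M, (N <= M)%N -> S = \sum_(i < M) u i.

Lemma esum_unique u S S' : esum_to u S -> esum_to u S' -> S = S'.
Proof.
by move=> [N H] [N' H']; rewrite (H (maxn N N')) ?(H' (maxn N N')) ?leq_maxl ?leq_maxr.
Qed.

Lemma esum_tail u S : esum_to u S -> exists N, forall i, (N <= i)%N -> u i = 0.
Proof.
move=> [N H]; exists N => i Hi; apply: (@addrI _ S); rewrite addr0 [RHS](H i.+1).
  by rewrite big_ord_recr /= -H.
exact: leqW.
Qed.

Lemma esum_of_tail u N : (forall i, (N <= i)%N -> u i = 0) -> esum_to u (\sum_(i < N) u i).
Proof.
move=> H; exists N => M /subnKC <-; rewrite big_split_ord /= [X in _ + X]big1 ?addr0 //.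
by move=> i _; rewrite H // leq_addr.
Qed.

Lemma esum_linear a u v S T : esum_to u S -> esum_to v T ->
  esum_to (fun i => a * u i + v i) (a * S + T).
Proof.
move=> [N H] [N' H']; exists (maxn N N') => M; rewrite geq_max => /andP[h h'].
by rewrite big_split /= -mulr_sumr -H -?H'.
Qed.

Lemma esum_eq u v S : u =1 v -> esum_to u S -> esum_to v S.
Proof. by move=> E [N H]; exists N => M /H ->; apply: eq_bigr => i _; rewrite E. Qed.

Lemma esum_sum (I : Type) (r : seq I) (u : I -> nat -> k) (S : I -> k) :
  (forall i, esum_to (u i) (S i)) ->
  esum_to (fun n => \sum_(i <- r) u i n) (\sum_(i <- r) S i).
Proof.
move=> H; elim: r => [|x r IH].
  by exists 0%N => M _; rewrite big_nil big1 // => i _; rewrite big_nil.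
rewrite big_cons -[S x]mul1r.
by apply: esum_eq (esum_linear 1 (H x) IH) => n; rewrite big_cons mul1r.
Qed.

(** The two sequences are the coefficients of two polynomials, and sums become
    values at 1. *)
Lemma esum_cauchy u v S T : esum_to u S -> esum_to v T ->
  esum_to (fun n => \sum_(j < n.+1) u j * v (n - j)%N) (S * T).
Proof.
move=> Hu Hv; have [N1 h1] := esum_tail Hu; have [N2 h2] := esum_tail Hv.
pose P := \poly_(i < N1) u i; pose Q := \poly_(i < N2) v i.
have cP i : P`_i = u i by rewrite coef_poly; case: ltnP => // /h1.
have cQ i : Q`_i = v i by rewrite coef_poly; case: ltnP => // /h2.
have eP : S = P.[1].
  rewrite (esum_unique Hu (esum_of_tail h1)) (horner_coef_wide _ (size_poly _ _)).
  by apply: eq_bigr => i _; rewrite expr1n mulr1 cP.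
have eQ : T = Q.[1].
  rewrite (esum_unique Hv (esum_of_tail h2)) (horner_coef_wide _ (size_poly _ _)).
  by apply: eq_bigr => i _; rewrite expr1n mulr1 cQ.
exists (size (P * Q)) => M HM; rewrite eP eQ -hornerM (horner_coef_wide _ HM).
apply: eq_bigr => n _; rewrite expr1n mulr1 coefM.
by apply: eq_bigr => j _; rewrite cP cQ.
Qed.
End Esum.

Section Exp.
Variables (k : fieldType) (char0 : [pchar k] =i pred0).

Lemma fact_neq0 n : (n`!%:R : k) != 0.
Proof. by have /pcharf0P -> := char0; rewrite -lt0n fact_gt0. Qed.

Definition is_exp (C : coalgType k) (f s : dual C) :=
  forall c, esum_to (fun i => (i`!%:R)^-1 * (f ^+ i) c) (s c).

Definition locally_nilpotent (C : coalgType k) (f : dual C) :=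
  forall c, exists N, forall i, (N <= i)%N -> (f ^+ i) c = 0.

Variable C : coalgType k.
Implicit Types f g s t : dual C.

Lemma is_exp_unique f s t : is_exp f s -> is_exp f t -> s = t.
Proof. by move=> Hs Ht; apply: dual_ext => c; apply: esum_unique (Hs c) (Ht c). Qed.

Lemma is_exp_exists f : locally_nilpotent f -> exists s, is_exp f s.
Proof.
move=> Hf.
have /choice[s Hs] c : exists S, esum_to (fun i => (i`!%:R)^-1 * (f ^+ i) c) S.
  have [N HN] := Hf c; eexists; apply: (@esum_of_tail _ _ N) => i /HN ->.
  by rewrite mulr0.
have lin_s : islin (s : C -> k^o).
  move=> a x y; apply: esum_unique (Hs _) _.
  apply: esum_eq (esum_linear a (Hs x) (Hs y)) => i.
  by rewrite dvalP mulrDr; congr (_ + _); exact: mulrCA.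
by exists (Dual lin_s) => c; exact: Hs.
Qed.

Lemma is_exp0 : is_exp (0 : dual C) 1.
Proof.
move=> c; exists 1%N => -[|M] // _.
rewrite big_ord_recl /= invr1 mul1r big1 ?addr0 // => i _.
by rewrite exprS mul0r mulr0.
Qed.

(** The binomial theorem in the convolution ring, evaluated at [c], is a Cauchy
    product for each pair in a representative of the coproduct of [c]. *)
Lemma is_expD f g s t : GRing.comm f g -> is_exp f s -> is_exp g t ->
  is_exp (f + g) (s * t).
Proof.
move=> fg Hs Ht c.
have := esum_sum (repr (comul c)) (fun p => esum_cauchy (Hs p.1) (Ht p.2)).
apply: esum_eq => n; rewrite addrC exprDn_comm; last exact: commr_sym.
rewrite dval_sum mulr_sumr exchange_big /=; apply: eq_bigr => j _.
rewrite dval_mulrn (commrX _ (commr_sym (commrX _ fg))) dval_mulE /=.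
rewrite -[X in _ = _ * X]mulr_natl !mulr_sumr; apply: eq_bigr => p _.
have -> : ('C(n, j)%:R : k) = n`!%:R * (j`!%:R)^-1 * ((n - j)`!%:R)^-1.
  have /bin_fact <- : (j <= n)%N by rewrite -ltnS.
  by rewrite !natrM -mulrA -invfM mulfK // mulf_neq0 ?fact_neq0.
by rewrite -mulrA mulrACA -[n`!%:R * _ * _]mulrA !mulKf ?fact_neq0 // -!mulrA; congr (_ * _);
  rewrite mulrCA.
Qed.

End Exp.

(** * Tensor products of coalgebras and pull-backs *)

Section TensCoalg.
Variables (k : fieldType) (C D : coalgType k).
Local Notation CD := (tens C D).

Definition tens_comul (t : CD) : tens CD CD :=
  \sw_(c, d <- t) \sw_(c1, c2 <- comul c) \sw_(d1, d2 <- comul d)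
    (c1 \ox d1) \ox (c2 \ox d2).
Definition tens_counit (t : CD) : k^o := \sw_(c, d <- t) counit c * counit d : k^o.

Fact tens_comul_lin : islin tens_comul.
Proof. by rewrite /tens_comul; lin. Qed.
Fact tens_counit_lin : islin tens_counit.
Proof. by rewrite /tens_counit; lin. Qed.

Fact tens_comulE c d : tens_comul (c \ox d) =
  \sw_(c1, c2 <- comul c) \sw_(d1, d2 <- comul d) (c1 \ox d1) \ox (c2 \ox d2).
Proof. by rewrite /tens_comul swe_tensor //; lin. Qed.
Fact tens_counitE c d : tens_counit (c \ox d) = counit c * counit d.
Proof. by rewrite /tens_counit swe_tensor //; lin. Qed.

Fact sw_tens_comul (X : lmodType k) (f : CD -> CD -> X) c d : bilin f ->
  (\sw_(p, q <- tens_comul (c \ox d)) f p q) =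
  \sw_(c1, c2 <- comul c) \sw_(d1, d2 <- comul d) f (c1 \ox d1) (c2 \ox d2).
Proof.
move=> Hf; rewrite tens_comulE sw_nest //; apply: eq_sw => c1 c2.
by rewrite sw_nest //; apply: eq_sw => d1 d2; rewrite swe_tensor.
Qed.

Fact tens_comulA (t : CD) :
    (\sw_(a, b <- tens_comul t) \sw_(a1, a2 <- tens_comul a) a1 \ox (a2 \ox b)) =
    (\sw_(a, b <- tens_comul t) \sw_(b1, b2 <- tens_comul b) a \ox (b1 \ox b2)).
Proof.
have bl : bilin (fun a b : CD => \sw_(a1, a2 <- tens_comul a) a1 \ox (a2 \ox b)).
  by lin; exact: tens_comul_lin.
have br : bilin (fun a b : CD => \sw_(b1, b2 <- tens_comul b) a \ox (b1 \ox b2)).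
  by lin; exact: tens_comul_lin.
apply: (tens_ext
  (f := fun t => \sw_(a, b <- tens_comul t) \sw_(a1, a2 <- tens_comul a) a1 \ox (a2 \ox b))
  (g := fun t => \sw_(a, b <- tens_comul t) \sw_(b1, b2 <- tens_comul b) a \ox (b1 \ox b2))).
- by apply: islin_swl bl _; exact: tens_comul_lin.
- by apply: islin_swl br _; exact: tens_comul_lin.
move=> c d; rewrite !sw_tens_comul //.
pose K (a1 a2 a3 : C) (b1 b2 b3 : D) := (a1 \ox b1) \ox ((a2 \ox b2) \ox (a3 \ox b3)).
transitivity (\sw_(c1, c2 <- comul c) \sw_(c11, c12 <- comul c1)
  \sw_(d1, d2 <- comul d) \sw_(d11, d12 <- comul d1) K c11 c12 c2 d11 d12 d2).
  apply: eq_sw => c1 c2; rewrite [RHS]sw_swap; apply: eq_sw => d1 d2.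
  by rewrite sw_tens_comul //; lin.
rewrite (sw_comulA (f := fun a1 a2 a3 => \sw_(d1, d2 <- comul d)
  \sw_(d11, d12 <- comul d1) K a1 a2 a3 d11 d12 d2)); last by rewrite /K; trilin.
apply: eq_sw => c1 c2.
transitivity (\sw_(c21, c22 <- comul c2) \sw_(d1, d2 <- comul d)
  \sw_(d21, d22 <- comul d2) K c1 c21 c22 d1 d21 d22).
  apply: eq_sw => c21 c22; apply: (sw_comulA (f := fun a b e => K c1 c21 c22 a b e)).
  by rewrite /K; trilin.
rewrite sw_swap; apply: eq_sw => d1 d2.
by rewrite sw_tens_comul //; lin.
Qed.

Fact tens_counitl (t : CD) : (\sw_(a, b <- tens_comul t) (tens_counit a : k) *: b) = t.
Proof.
have bl : bilin (fun a b : CD => (tens_counit a : k) *: b).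
  by apply: islin_bilin => [b|a]; [apply: (islin_scalel b tens_counit_lin) | lin].
apply: (tens_ext (f := fun t => \sw_(a, b <- tens_comul t) (tens_counit a : k) *: b)
  (g := fun t => t)) => //.
  by apply: islin_swl bl _; exact: tens_comul_lin.
move=> c d; rewrite sw_tens_comul //.
transitivity (\sw_(c1, c2 <- comul c) counit c1 *:
   \sw_(d1, d2 <- comul d) counit d1 *: (c2 \ox d2)).
  apply: eq_sw => c1 c2; rewrite (sw_apply _ _ (islin_scaler _ (@islin_id _ _))).
  by apply: eq_sw => d1 d2; rewrite tens_counitE scalerA.
rewrite (sw_counitl (f := fun c2 => \sw_(d1, d2 <- comul d) counit d1 *: (c2 \ox d2))); last by lin.
by rewrite (sw_counitl (f := fun d => c \ox d)) //; lin.
Qed.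

Fact tens_counitr (t : CD) : (\sw_(a, b <- tens_comul t) (tens_counit b : k) *: a) = t.
Proof.
have bl : bilin (fun a b : CD => (tens_counit b : k) *: a).
  by apply: islin_bilin => [b|a]; [lin | apply: (islin_scalel a tens_counit_lin)].
apply: (tens_ext (f := fun t => \sw_(a, b <- tens_comul t) (tens_counit b : k) *: a)
  (g := fun t => t)) => //.
  by apply: islin_swl bl _; exact: tens_comul_lin.
move=> c d; rewrite sw_tens_comul //.
transitivity (\sw_(c1, c2 <- comul c) counit c2 *:
   \sw_(d1, d2 <- comul d) counit d2 *: (c1 \ox d1)).
  apply: eq_sw => c1 c2; rewrite (sw_apply _ _ (islin_scaler _ (@islin_id _ _))).
  by apply: eq_sw => d1 d2; rewrite tens_counitE scalerA.
rewrite (sw_counitr (f := fun c2 => \sw_(d1, d2 <- comul d) counit d2 *: (c2 \ox d1))); last by lin.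
by rewrite (sw_counitr (f := fun d => c \ox d)) //; lin.
Qed.

HB.instance Definition _ :=
  GRing.isLinear.Build k CD (tens CD CD) *:%R tens_comul tens_comul_lin.
Fact tens_counit_linear : linear_for *%R (tens_counit : CD -> k).
Proof. exact: tens_counit_lin. Qed.
HB.instance Definition _ :=
  GRing.isLinear.Build k CD k *%R (tens_counit : CD -> k) tens_counit_linear.
HB.instance Definition _ := isCoalgebra.Build k CD tens_comulA tens_counitl tens_counitr.

Lemma sw_comul_tens (X : lmodType k) (f : CD -> CD -> X) c d : bilin f ->
  (\sw_(p, q <- comul (c \ox d)) f p q) =
  \sw_(c1, c2 <- comul c) \sw_(d1, d2 <- comul d) f (c1 \ox d1) (c2 \ox d2).
Proof. exact: sw_tens_comul. Qed.
Lemma counit_tens c d : counit (c \ox d) = counit c * counit d.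
Proof. exact: tens_counitE. Qed.
End TensCoalg.

Section Pull.
Variable k : fieldType.

Definition coalg_map (D C : coalgType k) (phi : D -> C) :=
  [/\ islin phi, forall d, counit (phi d) = counit d &
      forall d, comul (phi d) = \sw_(d1, d2 <- comul d) phi d1 \ox phi d2].

Variables (C D : coalgType k) (phi : D -> C) (Hphi : coalg_map phi).

Fact pull_lin (f : dual C) : islin (fun d => f (phi d) : k^o).
Proof. by case: Hphi => Hl _ _; exact: dval_bilin. Qed.
Definition pull f := Dual (pull_lin f).

Lemma pullE f d : pull f d = f (phi d). Proof. by []. Qed.

Lemma pull1 : pull 1 = 1.
Proof. by case: Hphi => _ Hc _; apply: dual_ext => d; exact: Hc. Qed.

Lemma pullM f g : pull (f * g) = pull f * pull g.
Proof.
case: Hphi => Hl _ Hm; apply: dual_ext => d; rewrite pullE !dval_mul Hm.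
have Hb : bilin (fun a b => f a * g b : k^o) by lin; exact: dvalP.
rewrite sw_nest //; apply: eq_swk => a b; rewrite swe_tensor //.
Qed.

Lemma pullX f n : pull (f ^+ n) = pull f ^+ n.
Proof. by elim: n => [|n IH]; rewrite ?pull1 // !exprS pullM IH. Qed.

(** Pull-back along a coalgebra map is a ring morphism for convolution. *)
Lemma is_exp_pull f s : is_exp f s -> is_exp (pull f) (pull s).
Proof. by move=> H d; apply: esum_eq (H (phi d)) => i; rewrite -pullX. Qed.
End Pull.

(** * Coalgebra maps out of the threefold tensor power *)

Section Triple.
Variables (k : fieldType) (A : bialgType k).
Local Notation A2 := (tens A A).
Local Notation A3 := (tens A (tens A A)).

Lemma sw_comul_mul (X : lmodType k) (f : A -> A -> X) x y : bilin f ->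
  (\sw_(a, b <- comul (x * y)) f a b) =
  \sw_(x1, x2 <- comul x) \sw_(y1, y2 <- comul y) f (x1 * y1) (x2 * y2).
Proof.
move=> Hf; rewrite comulM sw_nest //; apply: eq_sw => a b; rewrite sw_nest //.
by apply: eq_sw => c d; rewrite swe_tensor.
Qed.

Lemma bilin_dual (C : coalgType k) (f g : dual C) : bilin (fun a b : C => f a * g b : k^o).
Proof. by lin; exact: dvalP. Qed.

Lemma dval_mul2 (f g : dual A2) a b : (f * g) (a \ox b) =
  \sw_(a1, a2 <- comul a) \sw_(b1, b2 <- comul b)
    (f (a1 \ox b1) * g (a2 \ox b2) : k^o).
Proof. by rewrite dval_mul sw_comul_tens //; exact: bilin_dual. Qed.

Lemma dval_mul3 (f g : dual A3) a b c : (f * g) (a \ox (b \ox c)) =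
  \sw_(a1, a2 <- comul a) \sw_(b1, b2 <- comul b) \sw_(c1, c2 <- comul c)
    (f (a1 \ox (b1 \ox c1)) * g (a2 \ox (b2 \ox c2)) : k^o).
Proof.
rewrite dval_mul sw_comul_tens; last exact: bilin_dual.
apply: eq_swk => a1 a2; rewrite sw_comul_tens //.
by lin; apply: dval_bilin; exact: islin_tensr (@islin_id _ _).
Qed.

Lemma tens3_ext (X : lmodType k) (f g : A3 -> X) : islin f -> islin g ->
  (forall a b c, f (a \ox (b \ox c)) = g (a \ox (b \ox c))) -> f =1 g.
Proof.
move=> Hf Hg E t; apply: tens_ext => // a s.
apply: (tens_ext (f := fun s => f (a \ox s)) (g := fun s => g (a \ox s))) => //.
  by apply: (islin_comp Hf); exact: islin_tensr (@islin_id _ _).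
by apply: (islin_comp Hg); exact: islin_tensr (@islin_id _ _).
Qed.

Lemma coalg_map3 (C : coalgType k) (phi : A3 -> C) : islin phi ->
  (forall a b c, counit (phi (a \ox (b \ox c))) = counit a * (counit b * counit c)) ->
  (forall a b c, comul (phi (a \ox (b \ox c))) =
     \sw_(a1, a2 <- comul a) \sw_(b1, b2 <- comul b) \sw_(c1, c2 <- comul c)
       phi (a1 \ox (b1 \ox c1)) \ox phi (a2 \ox (b2 \ox c2))) ->
  coalg_map phi.
Proof.
move=> Hl Hc Hm.
have Hb : bilin (fun s t => phi s \ox phi t) by lin.
split=> //.
  apply: (tens3_ext (X := k^o) (f := fun t => counit (phi t)) (g := fun t => counit t)).
  - by lin.
  - by lin.
  by move=> a b c; rewrite Hc !counit_tens.
apply: (tens3_ext (f := fun t => comul (phi t))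
  (g := fun t => \sw_(s, r <- comul t) phi s \ox phi r)).
- by lin.
- by lin.
move=> a b c; rewrite Hm sw_comul_tens //; apply: eq_sw => a1 a2.
by rewrite sw_comul_tens //; lin; apply: (islin_comp Hl); exact: islin_tensr (@islin_id _ _).
Qed.

Definition mul12 (t : A3) : A2 := \sw_(a, s <- t) \sw_(b, c <- s) (a * b) \ox c.
Definition mul23 (t : A3) : A2 := \sw_(a, s <- t) \sw_(b, c <- s) a \ox (b * c).
Definition eps1 (t : A3) : A2 := \sw_(a, s <- t) counit a *: s.
Definition eps3 (t : A3) : A2 := \sw_(a, s <- t) \sw_(b, c <- s) counit c *: (a \ox b).

Lemma mul12E a b c : mul12 (a \ox (b \ox c)) = (a * b) \ox c.
Proof. by rewrite /mul12 !swe_tensor //; lin. Qed.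
Lemma mul23E a b c : mul23 (a \ox (b \ox c)) = a \ox (b * c).
Proof. by rewrite /mul23 !swe_tensor //; lin. Qed.
Lemma eps1E a b c : eps1 (a \ox (b \ox c)) = counit a *: (b \ox c).
Proof. by rewrite /eps1 swe_tensor //; lin. Qed.
Lemma eps3E a b c : eps3 (a \ox (b \ox c)) = counit c *: (a \ox b).
Proof. by rewrite /eps3 !swe_tensor //; lin. Qed.

Lemma mul12_coalg : coalg_map mul12.
Proof.
apply: coalg_map3 => [|a b c|a b c].
- by rewrite /mul12; lin.
- by rewrite mul12E counit_tens counitM mulrA.
rewrite mul12E [LHS]tens_comulE sw_comul_mul; last by lin.
apply: eq_sw => a1 a2; apply: eq_sw => b1 b2; apply: eq_sw => c1 c2.
by rewrite !mul12E.
Qed.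

Lemma mul23_coalg : coalg_map mul23.
Proof.
apply: coalg_map3 => [|a b c|a b c].
- by rewrite /mul23; lin.
- by rewrite mul23E counit_tens counitM.
rewrite mul23E [LHS]tens_comulE; apply: eq_sw => a1 a2.
rewrite sw_comul_mul; last by lin.
apply: eq_sw => b1 b2; apply: eq_sw => c1 c2.
by rewrite !mul23E.
Qed.

Lemma eps1_coalg : coalg_map eps1.
Proof.
apply: coalg_map3 => [|a b c|a b c].
- by rewrite /eps1; lin.
- by rewrite eps1E linearZ /= counit_tens.
rewrite eps1E linearZ /= [comul _]tens_comulE.
pose G (a : A) := counit a *: \sw_(b1, b2 <- comul b) \sw_(c1, c2 <- comul c)
  (b1 \ox c1) \ox (b2 \ox c2).
rewrite -/(G a) -(sw_counitl (f := G) a); last by rewrite /G; lin.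
apply: eq_sw => a1 a2; rewrite /G !(sw_apply _ _ (islin_scaler _ (@islin_id _ _))).
apply: eq_sw => b1 b2; rewrite !(sw_apply _ _ (islin_scaler _ (@islin_id _ _))).
apply: eq_sw => c1 c2; rewrite !eps1E.
rewrite (islinZ (f := fun u => u \ox _)); last by lin.
by rewrite (islinZ (f := fun u => _ \ox u)); last by lin.
Qed.

Lemma eps3_coalg : coalg_map eps3.
Proof.
apply: coalg_map3 => [|a b c|a b c].
- by rewrite /eps3; lin.
- by rewrite eps3E linearZ /= counit_tens mulrC mulrA.
rewrite eps3E linearZ /= [comul _]tens_comulE.
rewrite !(sw_apply _ _ (islin_scaler _ (@islin_id _ _))); apply: eq_sw => a1 a2.
rewrite !(sw_apply _ _ (islin_scaler _ (@islin_id _ _))); apply: eq_sw => b1 b2.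
pose G (c : A) := counit c *: ((a1 \ox b1) \ox (a2 \ox b2)).
rewrite -/(G c) -(sw_counitl (f := G) c); last by rewrite /G; lin.
apply: eq_sw => c1 c2; rewrite /G !eps3E.
rewrite (islinZ (f := fun u => u \ox _)); last by lin.
by rewrite (islinZ (f := fun u => _ \ox u)); last by lin.
Qed.

Lemma inl_coalg : coalg_map (fun a : A => a \ox (1 : A)).
Proof.
split=> [|a|a]; first by lin.
  by rewrite counit_tens counit1 mulr1.
rewrite [LHS]tens_comulE comul1; apply: eq_sw => a1 a2.
by rewrite swe_tensor //; lin.
Qed.

Lemma inr_coalg : coalg_map (fun a : A => (1 : A) \ox a).
Proof.
split=> [|a|a]; first by lin.
  by rewrite counit_tens counit1 mul1r.
rewrite [LHS]tens_comulE comul1 swe_tensor; last by lin.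
by [].
Qed.

End Triple.

(** * When the exponential is a multiplicative 2-cocycle *)

Section Legs.
Variables (k : fieldType) (A : bialgType k).
Local Notation A2 := (tens A A).
Implicit Types f g : dual A2.

Lemma scaler_sw (U W X : lmodType k) (t : tens U W) (f : U -> W -> X) (a : k) :
  a *: (\sw_(u, w <- t) f u w) = \sw_(u, w <- t) a *: f u w.
Proof. exact: sw_apply _ _ (islin_scaler _ (@islin_id _ _)). Qed.

Lemma dval_tensl f (b : A) : islin (fun a => f (a \ox b) : k^o).
Proof. by apply: dval_bilin; lin. Qed.
Lemma dval_tensr f (a : A) : islin (fun b => f (a \ox b) : k^o).
Proof. by apply: dval_bilin; exact: islin_tensr (@islin_id _ _). Qed.

Lemma pull_eps1E f a b c :
  pull (eps1_coalg A) f (a \ox (b \ox c)) = counit a * f (b \ox c).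
Proof. by rewrite (pullE (eps1_coalg A)) eps1E (islinZ _ _ (@dvalP _ _ f)). Qed.
Lemma pull_eps3E f a b c :
  pull (eps3_coalg A) f (a \ox (b \ox c)) = counit c * f (a \ox b).
Proof. by rewrite (pullE (eps3_coalg A)) eps3E (islinZ _ _ (@dvalP _ _ f)). Qed.
Lemma pull_mul12E f a b c :
  pull (mul12_coalg A) f (a \ox (b \ox c)) = f ((a * b) \ox c).
Proof. by rewrite (pullE (mul12_coalg A)) mul12E. Qed.
Lemma pull_mul23E f a b c :
  pull (mul23_coalg A) f (a \ox (b \ox c)) = f (a \ox (b * c)).
Proof. by rewrite (pullE (mul23_coalg A)) mul23E. Qed.

(** In the convolution products below the leg that meets a counit is absorbed. The
    first and the third are the two sides of the 2-cocycle condition. *)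
Lemma mul_eps1_mul23 f g a b c :
  (pull (eps1_coalg A) f * pull (mul23_coalg A) g) (a \ox (b \ox c)) =
  \sw_(b1, b2 <- comul b) \sw_(c1, c2 <- comul c)
    (f (b1 \ox c1) * g (a \ox (b2 * c2)) : k^o).
Proof.
rewrite dval_mul3.
pose G a := \sw_(b1, b2 <- comul b) \sw_(c1, c2 <- comul c)
  (f (b1 \ox c1) * g (a \ox (b2 * c2)) : k^o).
have HG : islin G by rewrite /G; lin; exact: dval_tensl.
rewrite -[RHS](sw_counitl a HG); apply: eq_swk => a1 a2.
rewrite /G scaler_sw; apply: eq_swk => b1 b2.
rewrite scaler_sw; apply: eq_swk => c1 c2.
by rewrite pull_eps1E pull_mul23E -mulrA.
Qed.

Lemma mul_mul23_eps1 f g a b c :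
  (pull (mul23_coalg A) f * pull (eps1_coalg A) g) (a \ox (b \ox c)) =
  \sw_(b1, b2 <- comul b) \sw_(c1, c2 <- comul c)
    (f (a \ox (b1 * c1)) * g (b2 \ox c2) : k^o).
Proof.
rewrite dval_mul3.
pose G a := \sw_(b1, b2 <- comul b) \sw_(c1, c2 <- comul c)
  (f (a \ox (b1 * c1)) * g (b2 \ox c2) : k^o).
have HG : islin G by rewrite /G; lin; exact: dval_tensl.
rewrite -[RHS](sw_counitr a HG); apply: eq_swk => a1 a2.
rewrite /G scaler_sw; apply: eq_swk => b1 b2.
rewrite scaler_sw; apply: eq_swk => c1 c2.
by rewrite pull_eps1E pull_mul23E mulrCA.
Qed.

Lemma mul_eps3_mul12 f g a b c :
  (pull (eps3_coalg A) f * pull (mul12_coalg A) g) (a \ox (b \ox c)) =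
  \sw_(a1, a2 <- comul a) \sw_(b1, b2 <- comul b)
    (f (a1 \ox b1) * g ((a2 * b2) \ox c) : k^o).
Proof.
rewrite dval_mul3; apply: eq_swk => a1 a2.
apply: eq_swk => b1 b2.
pose G c := (f (a1 \ox b1) * g ((a2 * b2) \ox c) : k^o).
have HG : islin G by rewrite /G; lin; exact: dval_tensr.
rewrite -[RHS](sw_counitl c HG); apply: eq_swk => c1 c2.
by rewrite pull_eps3E pull_mul12E -mulrA.
Qed.

Lemma mul_mul12_eps3 f g a b c :
  (pull (mul12_coalg A) f * pull (eps3_coalg A) g) (a \ox (b \ox c)) =
  \sw_(a1, a2 <- comul a) \sw_(b1, b2 <- comul b)
    (f ((a1 * b1) \ox c) * g (a2 \ox b2) : k^o).
Proof.
rewrite dval_mul3; apply: eq_swk => a1 a2.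
apply: eq_swk => b1 b2.
pose G c := (f ((a1 * b1) \ox c) * g (a2 \ox b2) : k^o).
have HG : islin G by rewrite /G; lin; exact: dval_tensr.
rewrite -[RHS](sw_counitr c HG); apply: eq_swk => c1 c2.
by rewrite pull_eps3E pull_mul12E mulrCA.
Qed.
End Legs.

Section ExpCocycle.
Variables (k : fieldType) (char0 : [pchar k] =i pred0) (A : bialgType k).
Local Notation A2 := (tens A A).
Variable eta : dual A2.

(** The four terms of the Hochschild coboundary of [eta]. *)
Definition J_eps1 := pull (eps1_coalg A) eta.
Definition J_mul23 := pull (mul23_coalg A) eta.
Definition J_eps3 := pull (eps3_coalg A) eta.
Definition J_mul12 := pull (mul12_coalg A) eta.

Lemma conv_mul (f g : dual A2) t : conv f g t = (f * g) t.
Proof.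
rewrite dval_mul.
have Hb := bilin_dual f g.
rewrite /comul /= /tens_comul sw_nest //; apply: eq_swk => a b.
rewrite sw_nest //; apply: eq_swk => a1 a2.
rewrite sw_nest //; apply: eq_swk => b1 b2.
by rewrite swe_tensor.
Qed.

Lemma conv_powE (f : dual A2) n t : conv_pow f n t = (f ^+ n) t.
Proof.
elim: n t => [|n IH] t; first by [].
rewrite exprS -conv_mul /conv_pow iterS -/(conv_pow f n).
by congr conv; apply/funext => u; exact: IH.
Qed.

Lemma locally_nilpotentN (C : coalgType k) (f : dual C) :
  locally_nilpotent f -> locally_nilpotent (- f).
Proof.
move=> Hf c; have [N HN] := Hf c; exists N => i /HN.
rewrite exprNn -signr_odd; case: (odd i); rewrite ?expr1 ?mulN1r ?mul1r // => E.
by apply/eqP; rewrite [_ == _]oppr_eq0 E.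
Qed.

(** The Hochschild condition says that J1 + J2 and J3 + J4 agree, so they have the
    same exponential; the commutation hypotheses split it as a product on either
    side, and these products are the two sides of the 2-cocycle condition. The
    inverse is the exponential of the opposite. *)
Theorem exp_cocycle : locally_nilpotent eta ->
  (forall a, eta (a \ox 1) = 0) -> (forall a, eta (1 \ox a) = 0) ->
  J_eps1 + J_mul23 = J_eps3 + J_mul12 ->
  GRing.comm J_eps1 J_mul23 -> GRing.comm J_eps3 J_mul12 ->
  exists2 sigma : {scalar A2}, is_conv_exp eta sigma & multiplicative_2cocycle sigma.
Proof.
move=> Hnil Hl Hr Hhoch H12 H34.
have [s Hs] := is_exp_exists Hnil.
have [t Ht] := is_exp_exists (locally_nilpotentN Hnil).
exists (dual_scalar s).
  move=> x; have [N HN] := Hs x; exists N => M /HN E.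
  by rewrite [LHS]E; apply: eq_bigr => i _; rewrite conv_powE.
have cN : GRing.comm eta (- eta) by apply: commrN.
split.
- exists (dual_scalar t); split=> x.
    have E : s * t = 1.
      apply/esym/(is_exp_unique (@is_exp0 _ _)); rewrite -[X in is_exp X](subrr eta).
      exact: is_expD.
    by rewrite [LHS]conv_mul E.
  have E : t * s = 1.
    apply/esym/(is_exp_unique (@is_exp0 _ _)); rewrite -[X in is_exp X](addNr eta).
    by apply: is_expD => //; apply: commr_sym.
  by rewrite [LHS]conv_mul E.
- move=> a b c.
  have e12 := is_expD char0 H12 (is_exp_pull _ Hs) (is_exp_pull _ Hs).
  have e34 := is_expD char0 H34 (is_exp_pull _ Hs) (is_exp_pull _ Hs).
  rewrite -Hhoch in e34; have := is_exp_unique e12 e34.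
  move/(congr1 (fun f : dual _ => f (a \ox (b \ox c)))); rewrite mul_eps1_mul23 mul_eps3_mul12.
  exact.
- have is_exp_pull1 (phi : A -> A2) (Hphi : coalg_map phi) :
    (forall a, eta (phi a) = 0) -> forall a, s (phi a) = counit a.
    move=> H a; have := is_exp_pull Hphi Hs.
    have -> : pull Hphi eta = 0 by apply: dual_ext => x; exact: H.
    by move/is_exp_unique/(_ (@is_exp0 _ _))/(congr1 (fun f : dual _ => f a)).
  move=> a; split; first exact: (is_exp_pull1 _ (inl_coalg A)).
  exact: (is_exp_pull1 _ (inr_coalg A)).
Qed.
End ExpCocycle.

(** * Free algebras and square-zero extensions *)

(** With one member, closure under [a *: x + y] gives a subspace; the empty
    predicate is allowed. *)
Definition lin_closed (k : fieldType) (U : lmodType k) (Q : U -> Prop) :=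
  forall a x y, Q x -> Q y -> Q (a *: x + y).

Section LinClosed.
Variables (k : fieldType) (U : lmodType k) (Q : U -> Prop) (HQ : lin_closed Q).
Lemma lin_closed_sum (I : Type) (r : seq I) (F : I -> U) :
  Q 0 -> (forall i, Q (F i)) -> Q (\sum_(i <- r) F i).
Proof.
move=> H0 HF; elim: r => [|i r IH]; first by rewrite big_nil.
by rewrite big_cons -[F i]scale1r; apply: HQ.
Qed.
Lemma lin_closed0 x : Q x -> Q 0.
Proof. by move=> Qx; rewrite -(addNr x) -scaleN1r; apply: HQ. Qed.
End LinClosed.

Lemma lin_closed_eq (k : fieldType) (U X : lmodType k) (f g : U -> X) :
  islin f -> islin g -> lin_closed (fun x => f x = g x).
Proof. by move=> Hf Hg a x y Ex Ey; rewrite Hf Hg Ex Ey. Qed.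

Section Span.
Variables (k : fieldType) (V : lmodType k) (R : algType k) (j : {linear V -> R}).

Definition word (s : seq V) : R := \prod_(v <- s) j v.

(** The linear span of the words, as the intersection of all subspaces that contain
    them. *)
Definition wspan : {pred R} := fun t =>
  `[< forall Q : R -> Prop, lin_closed Q -> (forall s, Q (word s)) -> Q t >].

Fact wspan_closed : subalg_closed wspan.
Proof.
split.
- by apply/asboolP => Q _ /(_ [::]); rewrite /word big_nil; exact.
- move=> a x y /asboolP Hx /asboolP Hy; apply/asboolP => Q HQ Hw.
  exact: HQ (Hx _ HQ Hw) (Hy _ HQ Hw).
- move=> x y /asboolP Hx /asboolP Hy; apply/asboolP => Q HQ Hw.
  apply: (Hx (fun x => Q (x * y))) => [a u v Hu Hv|s].
    by rewrite mulrDl -scalerAl; apply: HQ.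
  apply: (Hy (fun y => Q (word s * y))) => [a u v Hu Hv|r].
    by rewrite mulrDr -scalerAr; apply: HQ.
  by rewrite /word -big_cat; apply: Hw.
Qed.

Lemma wspan_gen v : j v \in wspan.
Proof. by apply/asboolP => Q _ /(_ [:: v]); rewrite /word big_seq1. Qed.

(** The subalgebra spanned by the words, as a type, so that the universal property
    of the free algebra can be applied to it. *)
Record wsub := WSub { wval : R; wvalP : wval \in wspan }.
HB.instance Definition _ := [isSub for wval].
HB.instance Definition _ := [Choice of wsub by <:].
HB.instance Definition _ := GRing.SubChoice_isSubAlgebra.Build k R wspan wsub
  (GRing.subalg_closed_semi wspan_closed).

Fact wval_linear : linear wval. Proof. by []. Qed.
Fact wval_monoid : monoid_morphism wval. Proof. by []. Qed.
HB.instance Definition _ := GRing.isLinear.Build k wsub R *:%R wval wval_linear.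
HB.instance Definition _ := GRing.isMonoidMorphism.Build wsub R wval wval_monoid.

Definition wgen (v : V) : wsub := WSub (wspan_gen v).
Fact wgen_linear : linear wgen.
Proof. by move=> a u v; apply: val_inj; rewrite /= !linearP. Qed.
HB.instance Definition _ := GRing.isLinear.Build k V wsub *:%R wgen wgen_linear.

(** Composing the map to the subalgebra spanned by the words with the inclusion
    gives an endomorphism that fixes the generators, hence is the identity. *)
Lemma free_algebra_ind :
  (forall (C : algType k) (f : {linear V -> C}),
    exists2 g : {lrmorphism R -> C}, (forall v, g (j v) = f v) &
      forall g' : {lrmorphism R -> C}, (forall v, g' (j v) = f v) ->
        forall t, g' t = g t) ->
  forall Q : R -> Prop, lin_closed Q -> (forall s, Q (word s)) -> forall t, Q t.
Proof.
move=> univ Q HQ Hw t.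
have [g Hg _] := univ wsub wgen.
have [h _ Hu] := univ R j.
have E : wval (g t) = t.
  rewrite -[RHS]/(idfun t) (Hu idfun) //.
  by rewrite -(Hu (wval \o g : {lrmorphism R -> R})) // => v; rewrite /= Hg.
by rewrite -E; have /asboolP := wvalP (g t); apply.
Qed.
End Span.

(** The square-zero extension of [k] by [V]: the product of two elements of [V]
    is zero. *)
Section Triv.
Variables (k : fieldType) (V : lmodType k).
Definition triv : Type := (k^o * V)%type.
HB.instance Definition _ := GRing.Lmodule.on triv.

Definition triv_mul (p q : triv) : triv := (p.1 * q.1, (p.1 : k) *: q.2 + (q.1 : k) *: p.2).
Definition triv_one : triv := (1, 0).
Lemma triv_eq (p q : triv) : p.1 = q.1 -> p.2 = q.2 -> p = q.
Proof. by case: p q => [? ?] [? ?] /= -> ->. Qed.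

Fact triv_mulA : associative triv_mul.
Proof.
move=> p q r; apply: triv_eq => /=; first by rewrite mulrA.
by rewrite !scalerDr !scalerA addrA [r.1 * q.1]mulrC [r.1 * p.1]mulrC.
Qed.
Fact triv_mul1 : left_id triv_one triv_mul.
Proof. by move=> p; apply: triv_eq => /=; rewrite ?mul1r // scale1r scaler0 addr0. Qed.
Fact triv_mul1r : right_id triv_one triv_mul.
Proof. by move=> p; apply: triv_eq => /=; rewrite ?mulr1 // scale1r scaler0 add0r. Qed.
Fact triv_mulDl : left_distributive triv_mul +%R.
Proof.
move=> p q r; apply: triv_eq; rewrite /= ?mulrDl //.
by rewrite scalerDl scalerDr addrACA.
Qed.
Fact triv_mulDr : right_distributive triv_mul +%R.
Proof.
move=> r p q; apply: triv_eq; rewrite /= ?mulrDr //.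
by rewrite scalerDl scalerDr addrACA.
Qed.
Fact triv_neq0 : triv_one != 0.
Proof. by apply/eqP => /(congr1 fst) /= /eqP; rewrite oner_eq0. Qed.
HB.instance Definition _ := GRing.Zmodule_isNzRing.Build triv
  triv_mulA triv_mul1 triv_mul1r triv_mulDl triv_mulDr triv_neq0.
Fact triv_scaleAl (a : k) (u v : triv) : a *: (u * v) = (a *: u) * v.
Proof.
by apply: triv_eq => /=; rewrite ?scalerAl // scalerDr !scalerA [a * v.1]mulrC.
Qed.
HB.instance Definition _ := GRing.Lmodule_isLalgebra.Build k triv triv_scaleAl.
Fact triv_scaleAr (a : k) (u v : triv) : a *: (u * v) = u * (a *: v).
Proof.
by apply: triv_eq => /=; rewrite ?scalerAr // scalerDr !scalerA [a * u.1]mulrC.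
Qed.
HB.instance Definition _ := GRing.Lalgebra_isAlgebra.Build k triv triv_scaleAr.

Definition triv_in (v : V) : triv := (0, v).
Fact triv_in_linear : linear triv_in.
Proof. by move=> a u v; apply: triv_eq => //=; rewrite addr0 [RHS]mulr0. Qed.
HB.instance Definition _ := GRing.isLinear.Build k V triv *:%R triv_in triv_in_linear.

Lemma triv_word (s : seq V) : size s != 1 -> (\prod_(v <- s) triv_in v).2 = 0.
Proof.
case: s => [|v [|w s]] // _; first by rewrite big_nil.
by rewrite !big_cons /= mul0r !scale0r addr0.
Qed.
Lemma triv_word_eq0 (s : seq V) : (2 <= size s)%N -> \prod_(v <- s) triv_in v = 0.
Proof.
case: s => [|v [|w s]] // _; apply: triv_eq; last by rewrite triv_word.
by rewrite big_cons /= mul0r.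
Qed.
End Triv.

(** * The Nichols algebra: generators, coproduct and degree one *)

Section Nichols.
Variables (k : fieldType) (H : hopfType k) (V : ydType H).
Variables (B : braidedBialgType H) (iota : {linear V -> B}).
Hypothesis nicholsB : is_nichols_algebra iota.

Lemma nichols_yd : yd_morphism iota.
Proof.
have [T [j [pi [[_ [ja jc] _ _] [[[pa pc] _ _] pj] _ _ _]]]] := nicholsB.
split=> [h v|v]; first by rewrite -!pj ja pa.
have Hb : bilin (fun (g : H) t => g \ox pi t) by lin; exact: linearP.
rewrite -pj pc jc sw_nest //.
by apply: eq_sw => g w; rewrite swe_tensor ?pj.
Qed.

Lemma nichols_primitive v : comul (iota v) = iota v \ox 1 + 1 \ox iota v.
Proof.
have [T [j [pi [[_ _ jp _] [[_ pc _] pj] _ _ _]]]] := nicholsB.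
have Hb : bilin (fun x1 x2 => pi x1 \ox pi x2) by lin; exact: linearP.
by rewrite -pj pc jp (islinD _ _ (swe_linear Hb)) !swe_tensor // rmorph1.
Qed.

Lemma nichols_ind (Q : B -> Prop) : lin_closed Q ->
  (forall s, Q (word iota s)) -> forall b, Q b.
Proof.
have [T [j [pi [[univ _ _ _] [_ pj] surj _ _]]]] := nicholsB.
move=> HQ Hw b; have [t <-] := surj b.
apply: (free_algebra_ind univ (Q := fun t => Q (pi t))) => [a x y Hx Hy|s].
  by rewrite linearP; apply: HQ.
have -> : pi (word j s) = word iota s; last exact: Hw.
by rewrite /word rmorph_prod; apply: eq_bigr => v _; exact: pj.
Qed.

(** The Nichols ideal is generated in degrees at least two, hence dies in the
    square-zero extension of [k] by [V]. *)
Lemma nichols_proj : exists p : B -> V,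
  [/\ islin p, forall v, p (iota v) = v &
      forall s, size s != 1 -> p (word iota s) = 0].
Proof.
have [T [j [pi [[univ _ _ _] [_ pj] surj [[G HG HI] _] _]]]] := nicholsB.
have [g Hg _] := univ _ (@triv_in k V).
have gw s : g (word j s) = \prod_(v <- s) (triv_in v : triv V).
  by rewrite /word rmorph_prod; apply: eq_bigr => v _; exact: Hg.
have gZ a x : g (a *: x) = a *: g x by exact: linearZ.
have kill t : pi t = 0 -> g t = 0.
  move/HI => Ht; apply: (Ht (fun t => g t = 0)) => [|y /HG[n n2 [s ->]]].
    split=> [|x y Hx Hy|a x b Hx]; first exact: raddf0.
      by rewrite raddfD /= Hx Hy addr0.
    by rewrite !rmorphM /= Hx mulr0 mul0r.
  rewrite raddf_sum big1 // => p _.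
  apply: etrans (gZ p.1 (word j p.2)) _.
  rewrite (etrans (gw p.2) (@triv_word_eq0 _ _ p.2 _)) ?scaler0 //.
  by rewrite size_tuple.
have /choice[q Hq] b : exists t, pi t = b by apply: surj.
have Eq t : (g (q (pi t))).2 = (g t).2.
  have : g (q (pi t) - t) = 0 by apply: kill; rewrite raddfB /= Hq subrr.
  by rewrite raddfB /= => /eqP; rewrite subr_eq0 => /eqP ->.
have lp : linear (fun b => (g (q b)).2).
  move=> a x y; rewrite -[in LHS](Hq x) -[in LHS](Hq y) -linearP Eq.
  by rewrite linearP.
exists (fun b => (g (q b)).2); split=> [//|v|s Hs]; first by rewrite -pj Eq Hg.
have <- : pi (word j s) = word iota s.
  by rewrite /word rmorph_prod; apply: eq_bigr => v _; exact: pj.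
by rewrite Eq gw triv_word.
Qed.
End Nichols.

(** * Words in the bosonization *)

Lemma bilin_compl (k : fieldType) (Y U W X : lmodType k) (F : U -> W -> X) (f : Y -> U) w :
  bilin F -> islin f -> islin (fun y => F (f y) w).
Proof. by case=> F1 _ Hf; exact: (islin_comp (F1 w)). Qed.
Lemma bilin_compr (k : fieldType) (Y U W X : lmodType k) (F : U -> W -> X) (f : Y -> W) u :
  bilin F -> islin f -> islin (fun y => F u (f y)).
Proof. by case=> _ F2 Hf; exact: (islin_comp (F2 u)). Qed.
Lemma islin_tens (k : fieldType) (U W : lmodType k) (u : U) : islin (@tensor k U W u).
Proof. exact: islin_tensr (@islin_id _ _). Qed.

(** Linearity of expressions built from an abstract bilinear map. The second
    clause is for the eta-contracted forms that arise when the variable is the last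
    argument. *)
Ltac blin HF := repeat first
  [ lin1 | exact: islin_tens
  | match goal with
    | |- islin (fun x => _ (@?f x) ?w) => apply: (bilin_compl (f := f) w HF)
    | |- islin (fun x => _ ?u (@?f x)) => apply: (bilin_compr (f := f) u HF)
    end ].

Section Words.
Variables (k : fieldType) (H : hopfType k) (V : ydType H).
Variables (B : braidedBialgType H) (iota : {linear V -> B}).
Hypothesis yd : yd_morphism iota.
Hypothesis prim : forall v, comul (iota v) = iota v \ox 1 + 1 \ox iota v.
Hypothesis span : forall Q : B -> Prop, lin_closed Q ->
  (forall s, Q (word iota s)) -> forall b, Q b.
Local Notation A := (bosonization B).

Definition inH (h : H) : A := 1 \ox h.
Definition inV (v : V) : A := iota v \ox 1.
Definition wordH (s : seq V) (h : H) : A := word iota s \ox h.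

Lemma inV_lin : islin inV. Proof. by rewrite /inV; lin. Qed.

Lemma inH_mulE h x g : inH h * (x \ox g : A) =
  \sw_(h1, h2 <- comul h) (act h1 x \ox (h2 * g) : A).
Proof. by rewrite /inH bosE; apply: eq_sw => h1 h2; rewrite mul1r. Qed.

Lemma mul_inHE x h g : (x \ox h : A) * inH g = x \ox (h * g).
Proof.
rewrite /inH bosE.
under eq_sw => h1 h2.
  rewrite act_one -scalerAr mulr1.
  rewrite (islinZ (f := fun z => z \ox (h2 * g))); last by lin.
  over.
by apply: (sw_counitl (f := fun h2 => x \ox (h2 * g))); lin.
Qed.

Lemma inHM g h : inH (g * h) = inH g * inH h.
Proof. by rewrite mul_inHE. Qed.
Lemma inH1 : inH 1 = 1. Proof. by []. Qed.

Lemma inV_mulE v x h : inV v * (x \ox h : A) = (iota v * x) \ox h.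
Proof.
rewrite /inV bosE comul1 swe_tensor; last by lin.
by rewrite act1 mul1r.
Qed.

Lemma wordH_nil h : wordH [::] h = inH h.
Proof. by rewrite /wordH /word big_nil. Qed.
Lemma wordH_cons v s h : wordH (v :: s) h = inV v * wordH s h.
Proof. by rewrite /wordH inV_mulE /word big_cons. Qed.
Lemma wordH_mul_inH s h g : wordH s h * inH g = wordH s (h * g).
Proof. exact: mul_inHE. Qed.
Lemma wordH_inH s h : wordH s h = wordH s 1 * inH h.
Proof. by rewrite wordH_mul_inH mul1r. Qed.
Lemma wordH_cat s r h : wordH s 1 * wordH r h = wordH (s ++ r) h.
Proof.
elim: s => [|v s IH]; first by rewrite wordH_nil inH1 mul1r.
by rewrite !wordH_cons -mulrA IH.
Qed.

Lemma inH_inV h v : inH h * inV v =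
  \sw_(h1, h2 <- comul h) inV (act h1 v) * inH h2.
Proof.
rewrite inH_mulE; apply: eq_sw => h1 h2.
by rewrite mul_inHE mul1r mulr1; case: yd => ->.
Qed.

Lemma counit_inH h : counit (inH h) = counit h.
Proof. by rewrite [LHS]bos_counitE counit_one mul1r. Qed.
(** Applying the counit axiom to a primitive element x gives x = eps(x) 1 + x. *)
Lemma counit_inV v : counit (inV v) = 0.
Proof.
rewrite [LHS]bos_counitE counit1 mulr1.
have := counitl (iota v); rewrite prim.
have Hb : bilin (fun a b : B => counit a *: b) by lin.
rewrite (islinD _ _ (swe_linear Hb)) !swe_tensor // counit_one scale1r.
move/(canRL (addrK _)); rewrite subrr => /(congr1 (@counit k B)).
rewrite linearZ linear0 /= counit_one => E.
by rewrite -[LHS]mulr1.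
Qed.
Lemma counit_wordH_cons v s h : counit (wordH (v :: s) h) = 0.
Proof. by rewrite wordH_cons counitM counit_inV mul0r. Qed.

Lemma sw_comul_inH (X : lmodType k) (F : A -> A -> X) h : bilin F ->
  (\sw_(a, b <- comul (inH h)) F a b) =
  \sw_(h1, h2 <- comul h) F (inH h1) (inH h2).
Proof.
move=> HF; rewrite sw_comulB // comul_one swe_tensor.
  rewrite coact_one swe_tensor; first by apply: eq_sw => h1 h2; rewrite mul1r.
  by blin HF.
by blin HF.
Qed.

Lemma sw_comul_inV (X : lmodType k) (F : A -> A -> X) v : bilin F ->
  (\sw_(a, b <- comul (inV v)) F a b) =
  F (inV v) 1 + \sw_(g, w <- coact v) F (inH g) (inV w).
Proof.
move=> HF.
have Hb : bilin (fun x1 x2 : B => \sw_(g, x20 <- coact x2)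
    \sw_(h1, h2 <- comul (1 : H)) F (x1 \ox (g * h1)) (x20 \ox h2)).
  by blin HF.
have Hb2 x1 : bilin (fun g (x20 : B) =>
    \sw_(h1, h2 <- comul (1 : H)) F (x1 \ox (g * h1)) (x20 \ox h2)).
  by blin HF.
have Hb3 x1 g (x20 : B) : bilin (fun (h1 h2 : H) => F (x1 \ox (g * h1)) (x20 \ox h2)).
  by blin HF.
rewrite sw_comulB // prim (islinD _ _ (swe_linear Hb)) !swe_tensor //; congr (_ + _).
  by rewrite coact_one swe_tensor // comul1 swe_tensor // mul1r.
case: yd => _ ->; rewrite sw_nest //; apply: eq_sw => g w.
by rewrite swe_tensor // comul1 swe_tensor // mulr1.
Qed.

Lemma wordH_ind (Q : A -> Prop) : lin_closed Q -> (forall s h, Q (wordH s h)) -> forall a, Q a.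
Proof.
move=> HQ Hw a; have Q0 : Q 0 by exact: lin_closed0 HQ _ (Hw [::] 1).
rewrite [a]tens_repr swe_sumE; apply: lin_closed_sum => // -[b h] /=.
apply: (span (Q := fun b => Q (b \ox h))) => [c x y Hx Hy|s]; last exact: Hw.
by rewrite (proj1 (tensor_bilin _ _) h); apply: HQ.
Qed.

Lemma wordH_ext (X : lmodType k) (f g : A -> X) : islin f -> islin g ->
  (forall s h, f (wordH s h) = g (wordH s h)) -> f =1 g.
Proof. by move=> Hf Hg E a; apply: (wordH_ind (lin_closed_eq Hf Hg)). Qed.

(** Left multiplication by [H] preserves the degree: [h * x] is [inV (h1 x) * h2],
    so [h] travels to the right end of a word. *)
Lemma inH_mul_ext n (X : lmodType k) (f g : A -> X) : islin f -> islin g ->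
  (forall s h, size s = n -> f (wordH s h) = g (wordH s h)) ->
  forall s h l, size s = n -> f (inH l * wordH s h) = g (inH l * wordH s h).
Proof.
move=> Hf Hg E s; elim: s n f g Hf Hg E => [|v s IH] n f g Hf Hg E h l En.
  by rewrite wordH_nil -inHM -wordH_nil E.
rewrite wordH_cons mulrA inH_inV !(sw_apply _ _ (islin_mull _ (@islin_id _ _))).
rewrite !sw_apply //; apply: eq_sw => h1 h2; rewrite -mulrA.
apply: (IH (size s) (fun a => f (inV (act h1 v) * a)) (fun a => g (inV (act h1 v) * a))) => //.
- by apply: (islin_comp Hf); exact: islin_mulr (@islin_id _ _).
- by apply: (islin_comp Hg); exact: islin_mulr (@islin_id _ _).
by move=> r m Er; rewrite -wordH_cons; apply: E; rewrite /= Er.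
Qed.

Lemma wordH_mul_ext n m (X : lmodType k) (f g : A -> X) : islin f -> islin g ->
  (forall s h, size s = (n + m)%N -> f (wordH s h) = g (wordH s h)) ->
  forall s h r l, size s = n -> size r = m ->
  f (wordH s h * wordH r l) = g (wordH s h * wordH r l).
Proof.
move=> Hf Hg E s h r l Es Er; rewrite wordH_inH -mulrA.
apply: (inH_mul_ext (n := m) (f := fun a => f (wordH s 1 * a))
  (g := fun a => g (wordH s 1 * a))) => //.
- by apply: (islin_comp Hf); exact: islin_mulr (@islin_id _ _).
- by apply: (islin_comp Hg); exact: islin_mulr (@islin_id _ _).
by move=> q u Eq; rewrite wordH_cat; apply: E; rewrite size_cat Es Eq.
Qed.

(** The coproduct is graded: to compute with the coproduct of a word of length [n],
    a bilinear map need only be known on pairs of words of total length [n]. *)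
Lemma sw_comul_wordH_ext n (X : lmodType k) (F G : A -> A -> X) : bilin F -> bilin G ->
  (forall s r h l, (size s + size r)%N = n ->
     F (wordH s h) (wordH r l) = G (wordH s h) (wordH r l)) ->
  forall s h, size s = n ->
  (\sw_(a, b <- comul (wordH s h)) F a b) = \sw_(a, b <- comul (wordH s h)) G a b.
Proof.
move=> HF HG E s; elim: s n F G HF HG E => [|v s IH] n F G HF HG E h En.
  rewrite wordH_nil !sw_comul_inH //; apply: eq_sw => h1 h2.
  by rewrite -!wordH_nil E.
(* [P F'] is [F'] precomposed with multiplication by the coproduct of [inV v]. *)
pose P (F' : A -> A -> X) a b :=
  F' (inV v * a) b + \sw_(g, w <- coact v) F' (inH g * a) (inV w * b).
have HP F' : bilin F' -> bilin (P F').
  move=> HF'; have [F1 F2] := HF'.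
  lin => c x y; rewrite /P.
    rewrite mulrDr -scalerAr F1 /=.
    rewrite (islin_swr (coact v) (f := fun x g w => F' (inH g * x) (inV w * _))).
      by rewrite scalerDr addrACA.
    by move=> g w; apply: (islin_comp (F1 _)); exact: islin_mulr (@islin_id _ _).
  rewrite F2 (islin_swr (coact v) (f := fun x g w => F' (inH g * _) (inV w * x))).
    by rewrite scalerDr addrACA.
  by move=> g w; apply: (islin_comp (F2 _)); exact: islin_mulr (@islin_id _ _).
have cP F' : bilin F' -> (\sw_(a, b <- comul (wordH (v :: s) h)) F' a b) =
    \sw_(a, b <- comul (wordH s h)) P F' a b.
  move=> HF'; rewrite wordH_cons sw_comul_mul // sw_swap; apply: eq_sw => a b.
  rewrite sw_comul_inV; first by rewrite /P mul1r.
  by blin HF'.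
rewrite !cP //; apply: (IH (size s)) => //; try exact: HP.
move=> s' r h' l Es.
have En' : n = (size s').+1 + size r by rewrite -En /= -Es.
rewrite /P -wordH_cons E /= ?En' //; congr (_ + _); apply: eq_sw => g w.
have [F1 F2] := HF; have [G1 G2] := HG.
apply: (inH_mul_ext (n := size s') (f := F^~ _) (g := G^~ _)) => //;
  [exact: F1 | exact: G1 | move=> q u Eq].
rewrite -wordH_cons; apply: E.
by rewrite /= Eq addnS En'.
Qed.

End Words.

(** * Two identities from the symmetric braiding *)

Section Eta.
Variables (k : fieldType) (H : hopfType k) (V : ydType H).
Variable eta : {scalar (tens V V)}.
Hypothesis symV : symmetric_braiding V.
Hypothesis eta_inv : H_invariant eta.

Lemma braiding_lin : islin (@braiding k H V).
Proof. by rewrite /braiding; lin. Qed.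

Lemma braidingE (x y : V) : braiding (x \ox y) = \sw_(g, x0 <- coact x) act g y \ox x0.
Proof. by rewrite /braiding swe_tensor //; lin. Qed.

Lemma sw_braiding (X : lmodType k) (f : V -> V -> X) (x y : V) : bilin f ->
  (\sw_(u, v <- braiding (x \ox y)) f u v) = \sw_(g, w <- coact x) f (act g y) w.
Proof.
by move=> Hf; rewrite braidingE sw_nest //; apply: eq_sw => g w; rewrite swe_tensor.
Qed.

(** Writing [x \ox x'] as a braided tensor c(u (x) v), the left side loses its
    coaction by invariance and the right side by c^2 = id; both become
    eta(z, u) eta(v, y). *)
Lemma eta_slide (z x x' y : V) :
  (\sw_(g, w <- coact x') (eta (x \ox act g y) * eta (z \ox w) : k^o)) =
  \sw_(g, w <- coact x) (eta (z \ox act g x') * eta (w \ox y) : k^o).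
Proof.
pose L t := \sw_(x, x' <- t) \sw_(g, w <- coact x')
  (eta (x \ox act g y) * eta (z \ox w) : k^o).
pose S t := \sw_(u, v <- t) (eta (z \ox u) * eta (v \ox y) : k^o).
have bL : bilin (fun x x' : V => \sw_(g, w <- coact x')
  (eta (x \ox act g y) * eta (z \ox w) : k^o)) by lin.
have bS : bilin (fun u v : V => (eta (z \ox u) * eta (v \ox y) : k^o)) by lin.
have LS t : L (braiding t) = S t.
  apply: (tens_ext (X := k^o) (f := fun t => L (braiding t)) (g := S)).
  - by apply: (islin_comp (swe_linear bL)); exact: braiding_lin.
  - exact: swe_linear bS.
  move=> u v; rewrite /L sw_braiding // /S swe_tensor //.
  transitivity (\sw_(g, u0 <- coact u) \sw_(g1, g2 <- comul g)
     (eta (act g1 v \ox act g2 y) * eta (z \ox u0) : k^o)).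
    symmetry; apply: (sw_coactA (X := k^o)
      (f := fun g1 g2 u0 => eta (act g1 v \ox act g2 y) * eta (z \ox u0) : k^o)).
    by trilin.
  pose f w := (eta (z \ox w) * eta (v \ox y) : k^o).
  have lf : islin f by rewrite /f; lin.
  rewrite -[RHS](sw_coact1 u lf); apply: eq_swk => g u0.
  rewrite -(sw_apply (Y := k^o) _ _ (g := fun c : k^o => c * eta (z \ox u0) : k^o)).
    by rewrite eta_inv /f -mulrA [_ * eta (z \ox _)]mulrC.
  by lin.
have LR : L (x \ox x') = S (braiding (x \ox x')) by rewrite -LS symV.
move: LR; rewrite /L swe_tensor // /S sw_braiding //.
Qed.

(** Moving [x] past the braided tensor c(y (x) y') with [eta_slide] produces a
    second braiding, which cancels the first one. *)
Lemma eta_slide2 (z x y y' : V) :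
  (\sw_(g, x0 <- coact x) \sw_(g', y0 <- coact y)
     (eta (z \ox act (g * g') y') * eta (x0 \ox y0) : k^o)) =
  eta (x \ox y) * eta (z \ox y').
Proof.
pose M t := \sw_(p, q <- t) (eta (x \ox p) * eta (z \ox q) : k^o).
have bM : bilin (fun p q : V => (eta (x \ox p) * eta (z \ox q) : k^o)) by lin.
transitivity (M (braiding (braiding (y \ox y')))); last first.
  by rewrite symV /M swe_tensor.
have MB t : M (braiding t) = \sw_(u, v <- t) \sw_(g, w <- coact u)
    (eta (x \ox act g v) * eta (z \ox w) : k^o).
  apply: (tens_ext (X := k^o) (f := fun t => M (braiding t))
    (g := fun t => \sw_(u, v <- t) \sw_(g, w <- coact u)
    (eta (x \ox act g v) * eta (z \ox w) : k^o))).
  - by apply: (islin_comp (swe_linear bM)); exact: braiding_lin.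
  - by lin.
  move=> u v; rewrite /M sw_braiding // swe_tensor //; by lin.
rewrite MB sw_braiding; last by lin.
rewrite sw_swap; apply: eq_swk => g' y0.
rewrite eta_slide; apply: eq_swk => g x0.
by rewrite actM.
Qed.

End Eta.

(** * The functional eta tilde: balance, degrees and commutation *)

(** Linearity of expressions built from elements of convolution rings. *)
Ltac dlin := repeat first
  [ lin1 | exact: islin_tens | exact: islin_mulr (@islin_id _ _)
  | match goal with
    | |- islin (fun x => dval ?f (@?g x)) => apply: (dval_bilin (f := g) f)
    end ].

Section EtaTilde.
Variables (k : fieldType) (H : hopfType k) (V : ydType H).
Variables (B : braidedBialgType H) (iota : {linear V -> B}).
Hypothesis yd : yd_morphism iota.
Hypothesis prim : forall v, comul (iota v) = iota v \ox 1 + 1 \ox iota v.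
Hypothesis span : forall Q : B -> Prop, lin_closed Q ->
  (forall s, Q (word iota s)) -> forall b, Q b.
Local Notation A := (bosonization B).
Local Notation A2 := (tens A A).
Local Notation A3 := (tens A A2).
Local Notation inV := (inV iota).
Local Notation inH := (@inH k H B).
Local Notation wordH := (wordH iota).
Variable eta : {scalar (tens V V)}.
Hypothesis symV : symmetric_braiding V.
Hypothesis eta_inv : H_invariant eta.
Variable E : dual A2.
(* [E] is eta tilde, described by its values on words. *)
Hypothesis E_deg : forall s r g h, ~~ ((size s == 1) && (size r == 1)) ->
  E (wordH s g \ox wordH r h) = 0.
Hypothesis E_gen : forall x y g h,
  E (wordH [:: x] g \ox wordH [:: y] h) = eta (x \ox act g y) * counit h.

Lemma zero_lin (U X : lmodType k) : islin (fun _ : U => 0 : X).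
Proof. by move=> a u v; rewrite scaler0 addr0. Qed.
Hint Resolve zero_lin : core.

Lemma E_degl s g b : size s != 1 -> E (wordH s g \ox b) = 0.
Proof.
move=> Hs; apply: (wordH_ext span (X := k^o) (f := fun b => E (wordH s g \ox b) : k^o)
  (g := fun _ => 0)) => //; first by dlin.
by move=> r h; apply: E_deg; rewrite (negbTE Hs).
Qed.
Lemma E_degr a r h : size r != 1 -> E (a \ox wordH r h) = 0.
Proof.
move=> Hr; apply: (wordH_ext span (X := k^o) (f := fun a => E (a \ox wordH r h) : k^o)
  (g := fun _ => 0)) => //; first by dlin.
by move=> s g; apply: E_deg; rewrite (negbTE Hr) andbF.
Qed.

Lemma E_inHl h b : E (inH h \ox b) = 0.
Proof. by rewrite -(wordH_nil iota) E_degl. Qed.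
Lemma E_inHr h a : E (a \ox inH h) = 0.
Proof. by rewrite -(wordH_nil iota) E_degr. Qed.

Lemma E_mul0r n m a s h r l : size s = n -> size r = m -> (n + m)%N != 1 ->
  E (a \ox (wordH s h * wordH r l)) = 0.
Proof.
move=> Hs Hr Hn; apply: (wordH_mul_ext (n := n) (m := m) yd (X := k^o)
  (f := fun b => E (a \ox b) : k^o) (g := fun _ => 0)) => //; first by dlin.
by move=> q u Hq; rewrite E_degr // Hq.
Qed.
Lemma E_mul0l n m a s h r l : size s = n -> size r = m -> (n + m)%N != 1 ->
  E ((wordH s h * wordH r l) \ox a) = 0.
Proof.
move=> Hs Hr Hn; apply: (wordH_mul_ext (n := n) (m := m) yd (X := k^o)
  (f := fun b => E (b \ox a) : k^o) (g := fun _ => 0)) => //; first by dlin.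
by move=> q u Hq; rewrite E_degl // Hq.
Qed.

Lemma inH_wordH1 h x g : inH h * wordH [:: x] g =
  \sw_(h1, h2 <- comul h) wordH [:: act h1 x] (h2 * g).
Proof.
rewrite wordH_cons mulrA (inH_inV yd) (sw_apply _ _ (islin_mull _ (@islin_id _ _))).
by apply: eq_sw => h1 h2; rewrite -mulrA wordH_nil -inHM -(wordH_nil iota) -wordH_cons.
Qed.

Lemma eta_counit (h : H) x y : (\sw_(h1, h2 <- comul h)
  (eta (act h1 x \ox act h2 y) : k^o)) = counit h * eta (x \ox y).
Proof. exact: eta_inv. Qed.

(** The next three lemmas say that eta tilde factors through the tensor product
    over [H], and that [H] acts trivially at both ends. *)
Lemma E_balM a h b : E ((a * inH h) \ox b) = E (a \ox (inH h * b)).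
Proof.
apply: (wordH_ext span (X := k^o) (f := fun a => E ((a * inH h) \ox b) : k^o)
  (g := fun a => E (a \ox (inH h * b)) : k^o)); [by dlin | by dlin | move=> s g].
apply: (wordH_ext span (X := k^o) (f := fun b => E ((wordH s g * inH h) \ox b) : k^o)
  (g := fun b => E (wordH s g \ox (inH h * b)) : k^o)); [by dlin | by dlin | move=> r l].
rewrite wordH_mul_inH; case: (eqVneq (size s) 1%N) => Hs; last by rewrite !E_degl.
case: (eqVneq (size r) 1%N) => Hr; last first.
  by rewrite E_degr // -(wordH_nil iota) (E_mul0r _ _ (n := 0%N) (m := size r)).
case: s r Hs Hr => [|x []] // [|y []] // _ _.
rewrite inH_wordH1 (sw_apply (Y := k^o) _ _ (@dval_tensr _ _ _ _)) E_gen.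
transitivity (\sw_(h1, h2 <- comul h) counit h2 *: (eta (x \ox act (g * h1) y) * counit l : k^o)).
  rewrite (sw_counitr (X := k^o) (f := fun h => eta (x \ox act (g * h) y) * counit l : k^o)) //.
  by lin.
apply: eq_swk => h1 h2; rewrite E_gen counitM actM.
exact: mulrCA.
Qed.

Lemma E_balR a h b : E (a \ox (b * inH h)) = counit h * E (a \ox b).
Proof.
apply: (wordH_ext span (X := k^o) (f := fun a => E (a \ox (b * inH h)) : k^o)
  (g := fun a => counit h * E (a \ox b) : k^o)); [by dlin | by dlin | move=> s g].
apply: (wordH_ext span (X := k^o) (f := fun b => E (wordH s g \ox (b * inH h)) : k^o)
  (g := fun b => counit h * E (wordH s g \ox b) : k^o)); [by dlin | by dlin | move=> r l].
rewrite wordH_mul_inH; case: (eqVneq (size s) 1%N) => Hs; last by rewrite !E_degl ?mulr0.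
case: (eqVneq (size r) 1%N) => Hr; last by rewrite !E_degr ?mulr0.
case: s r Hs Hr => [|x []] // [|y []] // _ _.
by rewrite !E_gen counitM mulrA mulrC.
Qed.

Lemma E_balL a h b : E ((inH h * a) \ox b) = counit h * E (a \ox b).
Proof.
apply: (wordH_ext span (X := k^o) (f := fun a => E ((inH h * a) \ox b) : k^o)
  (g := fun a => counit h * E (a \ox b) : k^o)); [by dlin | by dlin | move=> s g].
apply: (wordH_ext span (X := k^o) (f := fun b => E ((inH h * wordH s g) \ox b) : k^o)
  (g := fun b => counit h * E (wordH s g \ox b) : k^o)); [by dlin | by dlin | move=> r l].
case: (eqVneq (size s) 1%N) => Hs; last first.
  by rewrite E_degl ?mulr0 // -(wordH_nil iota) (E_mul0l _ _ (n := 0%N) (m := size s)).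
case: (eqVneq (size r) 1%N) => Hr; last by rewrite !E_degr ?mulr0.
case: s r Hs Hr => [|x []] // [|y []] // _ _.
rewrite inH_wordH1 (sw_apply (Y := k^o) _ _ (@dval_tensl _ _ _ _)) E_gen.
rewrite mulrA -eta_counit (sw_apply (Y := k^o) _ _ (g := fun c : k^o => c * counit l : k^o)).
  by apply: eq_swk => h1 h2; rewrite E_gen actM.
by lin.
Qed.

Lemma E_unitl a : E (1 \ox a) = 0. Proof. by rewrite -inH1 E_inHl. Qed.
Lemma E_unitr a : E (a \ox 1) = 0. Proof. by rewrite -inH1 E_inHr. Qed.

Lemma dual3_ext (f g : dual A3) :
  (forall s r q h l m, f (wordH s h \ox (wordH r l \ox wordH q m)) =
                       g (wordH s h \ox (wordH r l \ox wordH q m))) -> f = g.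
Proof.
move=> Hfg; apply: dual_ext.
apply: (tens3_ext (X := k^o) (f := f : A3 -> k^o) (g := g : A3 -> k^o)) => [||a b c].
- exact: (@dvalP _ _ f).
- exact: (@dvalP _ _ g).
apply: (wordH_ext span (X := k^o) (f := fun a => f (a \ox (b \ox c)) : k^o)
  (g := fun a => g (a \ox (b \ox c)) : k^o)); [by dlin | by dlin | move=> s h].
apply: (wordH_ext span (X := k^o) (f := fun b => f (wordH s h \ox (b \ox c)) : k^o)
  (g := fun b => g (wordH s h \ox (b \ox c)) : k^o)); [by dlin | by dlin | move=> r l].
by apply: (wordH_ext span (X := k^o) (f := fun c => f (wordH s h \ox (wordH r l \ox c)) : k^o)
  (g := fun c => g (wordH s h \ox (wordH r l \ox c)) : k^o)); [by dlin | by dlin | move=> q m].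
Qed.

(** If some argument is in degree 0, the identity is the balance of eta tilde over
    [H]; otherwise all four terms vanish for degree reasons. *)
Lemma E_hochschild : J_eps1 E + J_mul23 E = J_eps3 E + J_mul12 E.
Proof.
apply: dual3_ext => s r q h l m; rewrite !dval_add.
rewrite pull_eps1E pull_eps3E pull_mul12E pull_mul23E.
case: s => [|x s].
  by rewrite wordH_nil counit_inH E_balL !E_inHl mulr0 addr0 add0r.
case: r => [|y r].
  by rewrite wordH_nil E_inHl E_inHr !mulr0 !add0r E_balM.
case: q => [|z q].
  by rewrite wordH_nil counit_inH E_balR !E_inHr mulr0 addr0 add0r.
rewrite !(counit_wordH_cons prim) !mul0r !add0r.
rewrite (E_mul0r _ _ (n := (size r).+1) (m := (size q).+1)) //=; last by rewrite addnS.
by rewrite (E_mul0l _ _ (n := (size s).+1) (m := (size r).+1)) //= addnS.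
Qed.


Lemma sw_eq0 (U W X : lmodType k) (t : tens U W) : (\sw_(u, w <- t) (0 : X)) = 0.
Proof. by rewrite swe_sumE big1. Qed.

Lemma sw_comul_wordH0 (X : lmodType k) (F : A -> A -> X) s h : bilin F ->
  (forall r q l m, (size r + size q)%N = size s -> F (wordH r l) (wordH q m) = 0) ->
  (\sw_(a, b <- comul (wordH s h)) F a b) = 0.
Proof.
move=> HF F0; rewrite -[RHS](sw_eq0 X (comul (wordH s h))).
by apply: (sw_comul_wordH_ext (n := size s) yd prim) => //; split=> ?; exact: zero_lin.
Qed.

(** Each factor of the power consumes at least one letter of the left word. *)
Lemma E_pow0 n s h b : (size s < n)%N -> (E ^+ n) (wordH s h \ox b) = 0.
Proof.
elim: n s h b => // n IH s h b Hs; rewrite exprS dval_mul2.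
apply: (@sw_comul_wordH0 k^o); first by dlin.
move=> r q l m Erq; rewrite -[RHS](sw_eq0 k^o (comul b)).
apply: eq_swk => b1 b2.
case: (posnP (size r)) => Hr; first by rewrite E_degl ?mul0r // Hr.
by rewrite IH ?mulr0 //; lia.
Qed.

Lemma E_nilpotent : locally_nilpotent E.
Proof.
pose Q t := exists N, forall i, (N <= i)%N -> (E ^+ i) t = 0.
have HQ : lin_closed Q.
  move=> a x y [N HN] [M HM]; exists (maxn N M) => i; rewrite geq_max => /andP[/HN Ex /HM Ey].
  by rewrite [LHS](dvalP (E ^+ i)) Ex Ey scaler0 addr0.
have Qp a b : Q (a \ox b).
  apply: (wordH_ind span (Q := fun a => Q (a \ox b))) => [c x y Hx Hy|s h].
    by rewrite (proj1 (tensor_bilin _ _) b); apply: HQ.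
  by exists (size s).+1 => i Hi; apply: E_pow0.
move=> t; rewrite [t]tens_repr swe_sumE; apply: (lin_closed_sum HQ) => //.
exact: lin_closed0 HQ _ (Qp 0 0).
Qed.

Lemma mulr_sw (U W : lmodType k) (t : tens U W) (f : U -> W -> k) (a : k) :
  a * (\sw_(u, w <- t) (f u w : k^o)) = \sw_(u, w <- t) (a * f u w : k^o).
Proof. exact: (scaler_sw (X := k^o)). Qed.

(** A balanced functional is determined by its values on words without a factor in
    [H] (see [balanced_ext]): such factors move to the right end, where they act by
    the counit. *)
Definition balanced (J : dual A3) :=
  [/\ forall a b c h, J ((a * inH h) \ox (b \ox c)) = J (a \ox ((inH h * b) \ox c)),
      forall a b c h, J (a \ox ((b * inH h) \ox c)) = J (a \ox (b \ox (inH h * c))) &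
      forall a b c h, J (a \ox (b \ox (c * inH h))) = counit h * J (a \ox (b \ox c))].

Lemma balancedM J J' : balanced J -> balanced J' -> balanced (J * J').
Proof.
move=> [J1 J2 J3] [J'1 J'2 J'3]; split=> a b c h; rewrite !dval_mul3.
- rewrite sw_comul_mul; last by dlin.
  apply: eq_swk => a1 a2; rewrite sw_comul_inH; last by dlin.
  rewrite sw_comul_mul; last by dlin.
  rewrite sw_comul_inH; last by dlin.
  apply: eq_swk => h1 h2; apply: eq_swk => b1 b2.
  by apply: eq_swk => c1 c2; rewrite J1 J'1.
- apply: eq_swk => a1 a2.
  rewrite sw_comul_mul; last by dlin.
  apply: eq_swk => b1 b2; rewrite sw_comul_inH; last by dlin.
  rewrite sw_comul_mul; last by dlin.
  rewrite sw_comul_inH; last by dlin.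
  apply: eq_swk => h1 h2.
  by apply: eq_swk => c1 c2; rewrite J2 J'2.
rewrite mulr_sw; apply: eq_swk => a1 a2.
rewrite mulr_sw; apply: eq_swk => b1 b2.
rewrite sw_comul_mul; last by dlin.
rewrite mulr_sw; apply: eq_swk => c1 c2.
rewrite sw_comul_inH; last by dlin.
pose f (h : H) := (counit h * (J (a1 \ox (b1 \ox c1)) * J' (a2 \ox (b2 \ox c2))) : k^o).
have lf : islin f by rewrite /f; lin.
rewrite -[RHS](sw_counitl h lf); apply: eq_swk => h1 h2.
by rewrite J3 J'3 /f mulrACA -mulrA.
Qed.

Lemma balanced_ext J J' : balanced J -> balanced J' ->
  (forall s r q, J (wordH s 1 \ox (wordH r 1 \ox wordH q 1)) =
     J' (wordH s 1 \ox (wordH r 1 \ox wordH q 1))) ->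
  J = J'.
Proof.
move=> [J1 J2 J3] [J'1 J'2 J'3] HJ.
have Hc s r c : J (wordH s 1 \ox (wordH r 1 \ox c)) = J' (wordH s 1 \ox (wordH r 1 \ox c)).
  apply: (wordH_ext span (X := k^o) (f := fun c => J (wordH s 1 \ox (wordH r 1 \ox c)) : k^o)
    (g := fun c => J' (wordH s 1 \ox (wordH r 1 \ox c)) : k^o)); [by dlin | by dlin | move=> q m].
  by rewrite [wordH q m]wordH_inH J3 J'3 HJ.
have Hb s b c : J (wordH s 1 \ox (b \ox c)) = J' (wordH s 1 \ox (b \ox c)).
  apply: (wordH_ext span (X := k^o) (f := fun b => J (wordH s 1 \ox (b \ox c)) : k^o)
    (g := fun b => J' (wordH s 1 \ox (b \ox c)) : k^o)); [by dlin | by dlin | move=> q m].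
  by rewrite [wordH q m]wordH_inH J2 J'2 Hc.
by apply: dual3_ext => s r q h l m; rewrite [wordH s h]wordH_inH J1 J'1 Hb.
Qed.

Lemma balanced_eps1 : balanced (J_eps1 E).
Proof.
split=> a b c h; rewrite !pull_eps1E.
- by rewrite counitM counit_inH E_balL -mulrA.
- by rewrite E_balM.
by rewrite E_balR mulrCA.
Qed.
Lemma balanced_mul23 : balanced (J_mul23 E).
Proof.
split=> a b c h; rewrite !pull_mul23E.
- by rewrite E_balM mulrA.
- by rewrite mulrA.
by rewrite mulrA E_balR.
Qed.
Lemma balanced_eps3 : balanced (J_eps3 E).
Proof.
split=> a b c h; rewrite !pull_eps3E.
- by rewrite E_balM.
- by rewrite E_balR counitM counit_inH mulrA [counit h * _]mulrC.
by rewrite counitM counit_inH -mulrA mulrCA.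
Qed.
Lemma balanced_mul12 : balanced (J_mul12 E).
Proof.
split=> a b c h; rewrite !pull_mul12E.
- by rewrite mulrA.
- by rewrite mulrA E_balM.
by rewrite E_balR.
Qed.

Definition supp (J : dual A3) (D : nat -> nat -> nat -> bool) :=
  forall s r q h l m, ~~ D (size s) (size r) (size q) ->
  J (wordH s h \ox (wordH r l \ox wordH q m)) = 0.

(** The coproduct is graded, so degrees add under convolution. *)
Lemma suppM (D'' D D' : nat -> nat -> nat -> bool) J J' : supp J D -> supp J' D' ->
  (forall i i' j j' m m', D i j m -> D' i' j' m' ->
     D'' (i + i')%N (j + j')%N (m + m')%N) ->
  supp (J * J') D''.
Proof.
move=> HJ HJ' HD s r q h l m Hn; rewrite dval_mul3.
apply: (@sw_comul_wordH0 k^o); first by dlin.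
move=> s1 s2 h1 h2 Es; apply: (@sw_comul_wordH0 k^o); first by dlin.
move=> r1 r2 l1 l2 Er; apply: (@sw_comul_wordH0 k^o); first by dlin.
move=> q1 q2 m1 m2 Eq.
case: (boolP (D (size s1) (size r1) (size q1))) => [D1|/HJ ->]; last by rewrite mul0r.
case: (boolP (D' (size s2) (size r2) (size q2))) => [D2|/HJ' ->]; last by rewrite mulr0.
by have := HD _ _ _ _ _ _ D1 D2; rewrite Es Er Eq (negbTE Hn).
Qed.

Lemma supp_eps1 : supp (J_eps1 E) (fun i j m => [&& i == 0, j == 1 & m == 1])%N.
Proof.
move=> s r q h l m Hn; rewrite pull_eps1E; case: s Hn => [|x s] Hn; last first.
  by rewrite counit_wordH_cons // mul0r.
by rewrite E_deg ?mulr0.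
Qed.
Lemma supp_eps3 : supp (J_eps3 E) (fun i j m => [&& i == 1, j == 1 & m == 0])%N.
Proof.
move=> s r q h l m Hn; rewrite pull_eps3E; case: q Hn => [|x q] Hn; last first.
  by rewrite counit_wordH_cons // mul0r.
by rewrite E_deg ?mulr0 //; move: Hn; rewrite andbT.
Qed.
Lemma supp_mul23 : supp (J_mul23 E) (fun i j m => (i == 1) && (j + m == 1))%N.
Proof.
move=> s r q h l m Hn; rewrite pull_mul23E.
case: (eqVneq (size s) 1%N) Hn => [_|Hs] Hn; last by rewrite E_degl.
exact: (E_mul0r _ _ (n := size r) (m := size q)).
Qed.
Lemma supp_mul12 : supp (J_mul12 E) (fun i j m => (i + j == 1) && (m == 1))%N.
Proof.
move=> s r q h l m; rewrite andbC => Hn; rewrite pull_mul12E.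
case: (eqVneq (size q) 1%N) Hn => [_|Hs] Hn; last by rewrite E_degr.
exact: (E_mul0l _ _ (n := size s) (m := size r)).
Qed.

Lemma wordH1 x : wordH [:: x] 1 = inV x.
Proof. by rewrite wordH_cons wordH_nil inH1 mulr1. Qed.
Lemma wordH2 x y : wordH [:: x; y] 1 = inV x * inV y.
Proof. by rewrite wordH_cons wordH1. Qed.

Lemma E_VV x y : E (inV x \ox inV y) = eta (x \ox y).
Proof. by rewrite -!wordH1 E_gen act1 counit1 mulr1. Qed.
Lemma E_VHV x g y : E (inV x \ox (inH g * inV y)) = eta (x \ox act g y).
Proof. by rewrite -E_balM -!wordH1 wordH_mul_inH E_gen mul1r counit1 mulr1. Qed.
Lemma E_VVl x y b : E ((inV x * inV y) \ox b) = 0.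
Proof. by rewrite -wordH2 E_degl. Qed.
Lemma E_VVr x y a : E (a \ox (inV x * inV y)) = 0.
Proof. by rewrite -wordH2 E_degr. Qed.

(** The coproduct of a product of two primitive elements has components in degrees
    (2,0), (1,1) and (0,2). For [F] vanishing on the outer ones the two terms of the
    middle one remain, and the second one contains the braiding. *)
Lemma sw_comul_VV (X : lmodType k) (F : A -> A -> X) x x' : bilin F ->
  F (inV x * inV x') 1 = 0 ->
  (forall h w w', F (inH h) (inV w * inV w') = 0) ->
  (\sw_(a, b <- comul (inV x * inV x')) F a b) =
  (\sw_(g, w <- coact x') F (inV x * inH g) (inV w)) +
  \sw_(g, w <- coact x) F (inH g * inV x') (inV w).
Proof.
move=> HF F20 F02; rewrite sw_comul_mul // (sw_comul_inV yd prim); last first.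
  by blin HF; exact: islin_mulr (@islin_id _ _).
rewrite (sw_comul_inV yd prim); last by blin HF; exact: islin_mulr (@islin_id _ _).
rewrite mulr1 F20 add0r; congr (_ + _).
  by apply: eq_sw => g w; rewrite mul1r.
apply: eq_sw => g w; rewrite (sw_comul_inV yd prim); last by blin HF; exact: islin_mulr (@islin_id _ _).
rewrite mulr1 -[RHS]addr0; congr (_ + _).
rewrite -[RHS](sw_eq0 X (coact x')); apply: eq_sw => g' w'.
by rewrite -inHM F02.
Qed.

Lemma sw_coact_counit (f : V -> k^o) v : islin f ->
  (\sw_(g, w <- coact v) (counit g * f w : k^o)) = f v.
Proof. by move=> Hf; exact: sw_coact1. Qed.

(** On the left the terms are [\sw_(g, w <- coact x') eta(x, g y) eta(z, w)] and
    eta(x', y) eta(z, x); on the right they are eta(z, x) eta(x', y) and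
    [\sw_(g, w <- coact x) eta(z, g x') eta(w, y)], which [eta_slide] identifies with
    the first one. *)
Lemma comm_eps1_mul23_deg121 z x x' y :
  (J_eps1 E * J_mul23 E) (inV z \ox ((inV x * inV x') \ox inV y)) =
  (J_mul23 E * J_eps1 E) (inV z \ox ((inV x * inV x') \ox inV y)).
Proof.
rewrite mul_eps1_mul23 mul_mul23_eps1.
transitivity (\sw_(b1, b2 <- comul (inV x * inV x'))
    (E (b1 \ox inV y) * E (inV z \ox b2) : k^o)).
  apply: eq_swk => b1 b2; rewrite (sw_comul_inV yd prim); last by dlin.
  rewrite mulr1 -[RHS]addr0; congr (_ + _).
  rewrite -[RHS](sw_eq0 k^o (coact y)); apply: eq_swk => g w.
  by rewrite E_inHr mul0r.
rewrite sw_comul_VV; first last.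
- by move=> h w w'; rewrite E_inHl mul0r.
- by rewrite E_VVl mul0r.
- by dlin.
symmetry; transitivity (\sw_(b1, b2 <- comul (inV x * inV x'))
    (E (inV z \ox b1) * E (b2 \ox inV y) : k^o)).
  apply: eq_swk => b1 b2; rewrite (sw_comul_inV yd prim); last by dlin.
  rewrite E_unitr mulr0 add0r.
  rewrite -[RHS](sw_coact_counit (f := fun w => E (inV z \ox b1) * E (b2 \ox inV w))).
    by apply: eq_swk => g w; rewrite E_balR mulrA.
  by dlin; exact: inV_lin.
rewrite sw_comul_VV; first last.
- by move=> h w w'; rewrite E_inHr mul0r.
- by rewrite E_VVr mul0r.
- by dlin.
rewrite addrC; congr (_ + _).
  transitivity (\sw_(g, w <- coact x) (eta (z \ox act g x') * eta (w \ox y) : k^o)).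
    by apply: eq_swk => g w; rewrite E_VHV E_VV.
  rewrite -eta_slide //; apply: eq_swk => g w.
  by rewrite E_balM E_VHV E_VV.
transitivity (eta (z \ox x) * eta (x' \ox y)).
  rewrite -[RHS](sw_coact_counit (f := fun w => eta (z \ox x) * eta (w \ox y))).
    by apply: eq_swk => g w; rewrite E_balR !E_VV mulrA.
  by lin.
rewrite mulrC -[LHS](sw_coact_counit (f := fun w => eta (x' \ox y) * eta (z \ox w))).
  by apply: eq_swk => g w; rewrite E_balL !E_VV mulrA.
by lin.
Qed.

Lemma sw_add (U W X : lmodType k) (t : tens U W) (f g : U -> W -> X) :
  (\sw_(u, w <- t) (f u w + g u w)) = (\sw_(u, w <- t) f u w) + \sw_(u, w <- t) g u w.
Proof. by rewrite !swe_sumE big_split. Qed.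

(** Here one pair of terms is matched by [eta_slide], the other by [eta_slide2]. *)
Lemma comm_eps1_mul23_deg112 z x y y' :
  (J_eps1 E * J_mul23 E) (inV z \ox (inV x \ox (inV y * inV y'))) =
  (J_mul23 E * J_eps1 E) (inV z \ox (inV x \ox (inV y * inV y'))).
Proof.
rewrite mul_eps1_mul23 mul_mul23_eps1.
transitivity (\sw_(c1, c2 <- comul (inV y * inV y'))
    (E (inV x \ox c1) * E (inV z \ox c2) : k^o)).
  rewrite (sw_comul_inV yd prim); last by dlin.
  rewrite -[RHS]addr0; congr (_ + _).
    by apply: eq_swk => c1 c2; rewrite mul1r.
  rewrite -[RHS](sw_eq0 k^o (coact x)); apply: eq_swk => g w.
  rewrite -[RHS](sw_eq0 k^o (comul (inV y * inV y'))).
  by apply: eq_swk => c1 c2; rewrite E_inHl mul0r.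
rewrite sw_comul_VV; first last.
- by move=> h w w'; rewrite E_inHr mul0r.
- by rewrite E_VVr mul0r.
- by dlin.
symmetry; rewrite (sw_comul_inV yd prim); last by dlin.
transitivity (\sw_(g, w <- coact x) \sw_(c1, c2 <- comul (inV y * inV y'))
    (E (inV z \ox (inH g * c1)) * E (inV w \ox c2) : k^o)).
  rewrite -[RHS]add0r; congr (_ + _).
  rewrite -[RHS](sw_eq0 k^o (comul (inV y * inV y'))).
  by apply: eq_swk => c1 c2; rewrite E_unitl mulr0.
transitivity (\sw_(g, w <- coact x)
   ((eta (z \ox act g y) * eta (w \ox y') : k^o) +
    \sw_(g', w' <- coact y) (eta (z \ox act (g * g') y') * eta (w \ox w') : k^o))).
  apply: eq_swk => g w; rewrite sw_comul_VV; first last.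
  - by move=> h u u'; rewrite -inHM E_inHr mul0r.
  - by rewrite E_unitr mulr0.
  - by dlin.
  congr (_ + _).
    pose f u := (eta (z \ox act g y) * eta (w \ox u) : k^o).
    rewrite -[RHS](sw_coact_counit (f := f)); last by rewrite /f; lin.
    apply: eq_swk => g' w'.
    by rewrite mulrA E_balR E_VHV E_VV -mulrA.
  apply: eq_swk => g' w'.
  by rewrite mulrA -inHM E_VHV E_VV.
rewrite sw_add eta_slide2 // -eta_slide // [LHS]addrC; congr (_ + _).
  pose f u := (eta (x \ox y) * eta (z \ox u) : k^o).
  rewrite -[LHS](sw_coact_counit (f := f)); last by rewrite /f; lin.
  by apply: eq_swk => g w; rewrite E_balR !E_VV -mulrA.
by apply: eq_swk => g w; rewrite E_VHV E_VV.
Qed.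

Lemma comm_eps3_mul12_deg211 x x' y z :
  (J_eps3 E * J_mul12 E) ((inV x * inV x') \ox (inV y \ox inV z)) =
  (J_mul12 E * J_eps3 E) ((inV x * inV x') \ox (inV y \ox inV z)).
Proof.
rewrite mul_eps3_mul12 mul_mul12_eps3.
transitivity (\sw_(a1, a2 <- comul (inV x * inV x'))
    (E (a1 \ox inV y) * E (a2 \ox inV z) : k^o)).
  apply: eq_swk => a1 a2; rewrite (sw_comul_inV yd prim); last by dlin.
  rewrite mulr1 -[RHS]addr0; congr (_ + _).
  rewrite -[RHS](sw_eq0 k^o (coact y)); apply: eq_swk => g w.
  by rewrite E_inHr mul0r.
rewrite sw_comul_VV; first last.
- by move=> h w w'; rewrite E_inHl mul0r.
- by rewrite E_VVl mul0r.
- by dlin.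
symmetry; transitivity (\sw_(a1, a2 <- comul (inV x * inV x'))
    \sw_(g, w <- coact y) (E ((a1 * inH g) \ox inV z) * E (a2 \ox inV w) : k^o)).
  apply: eq_swk => a1 a2; rewrite (sw_comul_inV yd prim); last by dlin.
  by rewrite E_unitr mulr0 add0r.
rewrite sw_comul_VV; first last.
- move=> h w w'; rewrite -[RHS](sw_eq0 k^o (coact y)).
  by apply: eq_swk => g u; rewrite -inHM E_inHl mul0r.
- rewrite -[RHS](sw_eq0 k^o (coact y)).
  by apply: eq_swk => g u; rewrite E_unitl mulr0.
- by dlin.
rewrite addrC; congr (_ + _).
  transitivity (\sw_(g, w <- coact y) (eta (x' \ox act g z) * eta (x \ox w) : k^o)).
    pose f u := (\sw_(g, w <- coact y) (eta (x' \ox act g z) * eta (u \ox w) : k^o)).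
    rewrite -[RHS](sw_coact_counit (f := f)); last by rewrite /f; lin.
    apply: eq_swk => g u; rewrite mulr_sw.
    apply: eq_swk => g' w.
    by rewrite -mulrA E_balL E_balM E_VHV E_VV mulrA.
  rewrite eta_slide //; apply: eq_swk => g w.
  by rewrite E_balM E_VHV E_VV.
transitivity (\sw_(g, u <- coact x') \sw_(g', w <- coact y)
    (eta (x \ox act (g * g') z) * eta (u \ox w) : k^o)).
  apply: eq_swk => g u; apply: eq_swk => g' w.
  by rewrite -mulrA -inHM E_balM E_VHV E_VV.
rewrite eta_slide2 //.
pose f u := (eta (x' \ox y) * eta (u \ox z) : k^o).
rewrite -[LHS](sw_coact_counit (f := f)); last by rewrite /f; lin.
by apply: eq_swk => g w; rewrite E_balL !E_VV -mulrA.
Qed.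

Lemma comm_eps3_mul12_deg121 x y y' z :
  (J_eps3 E * J_mul12 E) (inV x \ox ((inV y * inV y') \ox inV z)) =
  (J_mul12 E * J_eps3 E) (inV x \ox ((inV y * inV y') \ox inV z)).
Proof.
rewrite mul_eps3_mul12 mul_mul12_eps3.
transitivity (\sw_(b1, b2 <- comul (inV y * inV y'))
    (E (inV x \ox b1) * E (b2 \ox inV z) : k^o)).
  rewrite (sw_comul_inV yd prim); last by dlin.
  rewrite -[RHS]addr0; congr (_ + _).
    by apply: eq_swk => b1 b2; rewrite mul1r.
  rewrite -[RHS](sw_eq0 k^o (coact x)); apply: eq_swk => g w.
  rewrite -[RHS](sw_eq0 k^o (comul (inV y * inV y'))).
  by apply: eq_swk => b1 b2; rewrite E_inHl mul0r.
rewrite sw_comul_VV; first last.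
- by move=> h w w'; rewrite E_inHr mul0r.
- by rewrite E_VVr mul0r.
- by dlin.
symmetry; rewrite (sw_comul_inV yd prim); last by dlin.
transitivity (\sw_(b1, b2 <- comul (inV y * inV y'))
    (E (b1 \ox inV z) * E (inV x \ox b2) : k^o)).
  rewrite -[RHS]add0r; congr (_ + _).
    rewrite -[RHS](sw_eq0 k^o (comul (inV y * inV y'))).
    by apply: eq_swk => b1 b2; rewrite E_unitl mulr0.
  pose f u := (\sw_(b1, b2 <- comul (inV y * inV y'))
    (E (b1 \ox inV z) * E (inV u \ox b2) : k^o)).
  have lf : islin f by rewrite /f; dlin; exact: inV_lin.
  rewrite -[RHS](sw_coact_counit x lf).
  apply: eq_swk => g w; rewrite mulr_sw.
  by apply: eq_swk => b1 b2; rewrite E_balL mulrA.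
rewrite sw_comul_VV; first last.
- by move=> h w w'; rewrite E_inHl mul0r.
- by rewrite E_VVl mul0r.
- by dlin.
rewrite [LHS]addrC; congr (_ + _).
  pose f u := (eta (y' \ox z) * eta (x \ox u) : k^o).
  transitivity (f y).
    rewrite -[RHS](sw_coact_counit (f := f)); last by rewrite /f; lin.
    by apply: eq_swk => g w; rewrite E_balL !E_VV mulrA.
  pose f' u := (eta (x \ox y) * eta (u \ox z) : k^o).
  rewrite {}/f mulrC -[LHS](sw_coact_counit (f := f')); last by rewrite /f'; lin.
  by apply: eq_swk => g w; rewrite E_balR !E_VV -mulrA.
transitivity (\sw_(g, w <- coact y') (eta (y \ox act g z) * eta (x \ox w) : k^o)).
  by apply: eq_swk => g w; rewrite E_balM E_VHV E_VV.
rewrite eta_slide //; apply: eq_swk => g w.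
by rewrite E_VHV E_VV.
Qed.

(** Outside of degrees (1,1,2) and (1,2,1) both products vanish. *)
Lemma comm_eps1_mul23 : GRing.comm (J_eps1 E) (J_mul23 E).
Proof.
pose D i j m := [&& i == 1, j + m == 3, 0 < j & 0 < m]%N.
have s12 : supp (J_eps1 E * J_mul23 E) D.
  apply: suppM supp_eps1 supp_mul23 _ => i i' j j' m m'; rewrite /D; lia.
have s21 : supp (J_mul23 E * J_eps1 E) D.
  apply: suppM supp_mul23 supp_eps1 _ => i i' j j' m m'; rewrite /D; lia.
apply: balanced_ext => [||s r q].
- exact: balancedM balanced_eps1 balanced_mul23.
- exact: balancedM balanced_mul23 balanced_eps1.
case: (boolP (D (size s) (size r) (size q))) => [|HD]; last by rewrite s12 ?s21.
rewrite {s12 s21}/D.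
case: s => [|z [|? ?]] //; case: r => [|x [|x' [|? ?]]] //;
  case: q => [|y [|y' [|? ?]]] //= HD;
  try (exfalso; lia).
  by rewrite !wordH1 wordH2; exact: comm_eps1_mul23_deg112.
by rewrite !wordH1 wordH2; exact: comm_eps1_mul23_deg121.
Qed.

(** Outside of degrees (1,2,1) and (2,1,1) both products vanish. *)
Lemma comm_eps3_mul12 : GRing.comm (J_eps3 E) (J_mul12 E).
Proof.
pose D i j m := [&& m == 1, i + j == 3, 0 < i & 0 < j]%N.
have s12 : supp (J_eps3 E * J_mul12 E) D.
  apply: suppM supp_eps3 supp_mul12 _ => i i' j j' m m'; rewrite /D; lia.
have s21 : supp (J_mul12 E * J_eps3 E) D.
  apply: suppM supp_mul12 supp_eps3 _ => i i' j j' m m'; rewrite /D; lia.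
apply: balanced_ext => [||s r q].
- exact: balancedM balanced_eps3 balanced_mul12.
- exact: balancedM balanced_mul12 balanced_eps3.
case: (boolP (D (size s) (size r) (size q))) => [|HD]; last by rewrite s12 ?s21.
rewrite {s12 s21}/D.
case: q => [|z [|? ?]] //; case: s => [|x [|x' [|? ?]]] //;
  case: r => [|y [|y' [|? ?]]] //= HD;
  try (exfalso; lia).
  by rewrite !wordH1 wordH2; exact: comm_eps3_mul12_deg121.
by rewrite !wordH1 wordH2; exact: comm_eps3_mul12_deg211.
Qed.

End EtaTilde.

(** * Existence of eta tilde *)

Section Final.
Variables (k : fieldType) (H : hopfType k) (V : ydType H).
Variables (B : braidedBialgType H) (iota : {linear V -> B}).
Local Notation A := (bosonization B).

Lemma bos_homog_wordH s h : bos_homog iota (size s) (wordH iota s h).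
Proof.
exists [:: (word iota s, h)]; last by rewrite big_seq1.
move=> p; rewrite inE => /eqP -> /=; exists [:: (1, in_tuple s)].
by rewrite big_seq1 scale1r.
Qed.

Lemma islin_sum (U X : lmodType k) (f : U -> X) (I : Type) (r : seq I) (F : I -> U) :
  islin f -> f (\sum_(i <- r) F i) = \sum_(i <- r) f (F i).
Proof.
move=> Hf; elim: r => [|i r IH]; first by rewrite !big_nil islin0.
by rewrite !big_cons islinD // IH.
Qed.

Section Existence.
Variables (p : B -> V) (eta : {scalar (tens V V)}).
Hypotheses (lp : islin p) (p_iota : forall v, p (iota v) = v).
Hypothesis p_word : forall s, size s != 1 -> p (word iota s) = 0.

Lemma proj_homog n x : n != 1 -> homog iota n x -> p x = 0.
Proof.
move=> Hn [s ->]; rewrite islin_sum // big1 // => q _.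
by rewrite islinZ // (p_word (s := q.2)) ?scaler0 // size_tuple.
Qed.

(** The formula for eta tilde in degree (1,1), extended by means of the projection
    [p] of the Nichols algebra onto [V]. *)
Definition eta_form (a b : A) : k^o := \sw_(x, h <- a) \sw_(y, h' <- b)
  (eta (p x \ox act h (p y)) * counit h' : k^o).

Lemma eta_form_bilin : bilin eta_form.
Proof. by rewrite /eta_form; lin; exact: lp. Qed.

Lemma eta_formE x h y h' : eta_form (x \ox h) (y \ox h') =
  eta (p x \ox act h (p y)) * counit h'.
Proof.
by rewrite /eta_form !swe_tensor //; lin; exact: lp.
Qed.

Lemma eta_form_eq0l n a b : n != 1 -> bos_homog iota n a -> eta_form a b = 0.
Proof.
move=> Hn [s Hs ->].
rewrite (islin_sum (X := k^o) _ _ (proj1 eta_form_bilin b)) big_seq big1 // => q /Hs Hq.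
apply: (tens_ext (X := k^o) (f := eta_form (q.1 \ox q.2)) (g := fun _ => 0)).
- exact: (proj2 eta_form_bilin).
- exact: zero_lin.
move=> y h'; rewrite eta_formE (proj_homog Hn Hq).
by rewrite (islin0 (f := fun u => u \ox _)) ?linear0 ?mul0r //; lin.
Qed.

Lemma eta_form_eq0r n a b : n != 1 -> bos_homog iota n b -> eta_form a b = 0.
Proof.
move=> Hn [s Hs ->].
rewrite (islin_sum (X := k^o) _ _ (proj2 eta_form_bilin a)) big_seq big1 // => q /Hs Hq.
apply: (tens_ext (X := k^o) (f := eta_form^~ (q.1 \ox q.2)) (g := fun _ => 0)).
- exact: (proj1 eta_form_bilin).
- exact: zero_lin.
move=> x h; rewrite eta_formE (proj_homog Hn Hq).
rewrite (islin0 (f := fun u => p x \ox act h u)) ?linear0 ?mul0r //.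
by lin; exact: (proj2 (act_bilin (s := V)) h).
Qed.

Definition eta_tilde : {scalar (tens A A)} :=
  dual_scalar (Dual (swe_linear eta_form_bilin)).

Lemma eta_tildeP : is_eta_tilde iota eta eta_tilde.
Proof.
have E a b : eta_tilde (a \ox b) = eta_form a b.
  by rewrite /eta_tilde /= swe_tensor //; exact: eta_form_bilin.
split=> [m n a b Ha Hb Hmn|x y h h']; last by rewrite E eta_formE !p_iota.
rewrite E; case: (eqVneq m 1%N) Hmn Ha => [-> Hmn _|Hm _ Ha]; last exact: eta_form_eq0l Hm Ha.
apply: eta_form_eq0r Hb; apply: contraNneq Hmn => ->; exact: eqxx.
Qed.
End Existence.
End Final.

Theorem corollary2p6 (k : closedFieldType) (char0 : [pchar k] =i pred0)
    (H : hopfType k) (ssH : semisimple H)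
    (V : ydType H) (symV : symmetric_braiding V)
    (B : braidedBialgType H) (iota : {linear V -> B})
    (nicholsB : is_nichols_algebra iota)
    (eta : {scalar (tens V V)}) (eta_inv : H_invariant eta) :
  (exists etat : {scalar (tens (bosonization B) (bosonization B))},
     is_eta_tilde iota eta etat) /\
  (forall etat : {scalar (tens (bosonization B) (bosonization B))},
     is_eta_tilde iota eta etat ->
     exists2 sigma : {scalar (tens (bosonization B) (bosonization B))},
       is_conv_exp etat sigma & multiplicative_2cocycle sigma).
Proof.
split.
  have [p [lp p_iota p_word]] := nichols_proj nicholsB.
  by exists (eta_tilde eta lp); exact: eta_tildeP.
move=> etat [Hdeg Hgen].
have yd := nichols_yd nicholsB.
have prim := nichols_primitive nicholsB.
have span := nichols_ind nicholsB.
pose E := scalar_dual etat.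
have E_deg s r g h : ~~ ((size s == 1%N) && (size r == 1%N)) ->
    E (wordH iota s g \ox wordH iota r h) = 0.
  by move=> Hsr; apply: (Hdeg (size s) (size r)) => //; exact: bos_homog_wordH.
have E_gen x y g h : E (wordH iota [:: x] g \ox wordH iota [:: y] h) =
    eta (x \ox act g y) * counit h.
  by rewrite -Hgen /wordH /word !big_seq1.
apply: (exp_cocycle char0 (eta := E)).
- exact: (E_nilpotent yd prim span E_deg).
- by move=> a; apply: (E_unitr span E_deg).
- by move=> a; apply: (E_unitl span E_deg).
- exact: (E_hochschild yd prim span eta_inv E_deg E_gen).
- exact: (comm_eps1_mul23 yd prim span symV eta_inv E_deg E_gen).
exact: (comm_eps3_mul12 yd prim span symV eta_inv E_deg E_gen).
Qed.
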